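(* Let $N\ge1$, $r\ge2$, and let $(\rho_k)_{k\in\mathbf N}$ be a diverging sequence of representations $\rho_k:\mathbf F_r\to\mathrm{Isom}\,\mathbf H^N$ with minimal joint displacements $r_k$. Fix a non-principal ultrafilter $\omega$ on $\mathbf N$ and assume that the limiting action $\rho_\infty$ of $\mathbf F_r$ on the minimal tree $T$ is Schottky. Then $$\omega\text{-}\lim_k\; r_k\cdot\mathrm{Hdim}(\Lambda_{\rho_k})=\mathrm{Hdim}(\Lambda_{\rho_\infty}).$$
   Context: $\mathbf F_r$ is the free group on generators $S=\{s_1,\dots,s_r\}$ with word length $|\cdot|$; $(\mathbf H^N,d)$ is real hyperbolic space. Diverging sequences and limit trees. The minimal joint displacement of $\rho_k$ is $r_k:=\inf_{x\in\mathbf H^N}\max_{s\in S}d(x,\rho_k(s)x)$, and $(\rho_k)$ is diverging if $r_k\to+\infty$. Choose $o_k\in\mathbf H^N$ with $\max_{s\in S}d(o_k,\rho_k(s)o_k)\le r_k+1$. The asymptotic cone $(X_\omega,d_\omega,o_\omega)$ of $X_k=(\mathbf H^N,r_k^{-1}d,o_k)$ is the set of sequences $(x_k)$ in $\mathbf H^N$ with $\omega\text{-}\lim r_k^{-1}d(x_k,o_k)<\infty$, modulo $(x_k)\sim(y_k)$ iff $\omega\text{-}\lim r_k^{-1}d(x_k,y_k)=0$, with $d_\omega([(x_k)],[(y_k)])=\omega\text{-}\lim r_k^{-1}d(x_k,y_k)$ and $o_\omega=[(o_k)]$. It is a real tree, on which $\mathbf F_r$ acts isometrically by $\gamma\cdot[(x_k)]=[(\rho_k(\gamma)x_k)]$.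 It contains a unique minimal closed convex invariant subtree $T$ (the union of the axes of the hyperbolic elements), which is separable and pointed at $o_\omega$; $\rho_\infty:\mathbf F_r\to\mathrm{Isom}\,T$ denotes the resulting action. Schottky. For a complete pointed $\mathrm{CAT}(-1)$-space $(X,d,o)$, a representation $\rho:\mathbf F_r\to\mathrm{Isom}\,X$ is Schottky if for some $K\ge 1$ the orbit map $\gamma\mapsto\rho(\gamma)o$ is a $K$-quasi-isometric embedding: $\frac1K|\gamma^{-1}\gamma'|-K\le d(\rho(\gamma)o,\rho(\gamma')o)\le K|\gamma^{-1}\gamma'|+K$. Limit sets. The limit set $\Lambda_\rho\subset\partial X$ is the set of accumulation points in the boundary $\partial X$ of the orbit of $o$ (for Schottky $\rho$ it is the image of $\partial\mathbf F_r$ under the continuous extension of the orbit map). $\mathrm{Hdim}$ is the Hausdorff dimension for the visual distance $d_o(\xi,\zeta)=e^{-\langle\xi,\zeta\rangle_o}$ on $\partial X$, where $\langle x,y\rangle_o=\frac12(d(x,o)+d(y,o)-d(x,y))$ is the Gromov product extended continuously to $\partial X$. This is used with $X=\mathbf H^N$ (metric $d$) for $\rho_k$, and with $X=T$ (metric $d_\omega$) for $\rho_\infty$. *)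

(* Defs.v *)
From HB Require Import structures.
From mathcomp Require Import all_boot all_order all_algebra.
From mathcomp Require Import all_classical all_reals all_analysis.
Set Implicit Arguments.
Unset Strict Implicit.
Unset Printing Implicit Defensive.
Import Order.TTheory GRing.Theory Num.Theory.
Import numFieldNormedType.Exports.
Local Open Scope classical_set_scope.
Local Open Scope ring_scope.

(* The free group is realised as the set of reduced words. *)

Section FreeGroup.
Variable r : nat.

(* [(i, true)] stands for the generator s_i and [(i, false)] for its inverse *)
Definition letter : Type := 'I_r * bool.
HB.instance Definition _ := Choice.on letter.

Definition letter_inv (a : letter) : letter := (a.1, ~~ a.2).

Definition reduced (w : seq letter) : bool :=
  sorted (fun a b => b != letter_inv a) w.

Definition letter_cons (a : letter) (w : seq letter) : seq letter :=
  if w is b :: w' then if b == letter_inv a then w' else a :: w else [:: a].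

Definition word_mul (u v : seq letter) : seq letter := foldr letter_cons v u.

Definition word_inv (u : seq letter) : seq letter := rev (map letter_inv u).

Lemma letter_invK : involutive letter_inv.
Proof. by case=> i b; rewrite /letter_inv /= negbK. Qed.

Lemma reduced_tl a w : reduced (a :: w) -> reduced w.
Proof. exact: path_sorted. Qed.

Lemma reduced_letter_cons a w : reduced w -> reduced (letter_cons a w).
Proof.
case: w => [//|b w] /=; case: eqVneq => [_|ba] bw; first exact: reduced_tl bw.
by rewrite /reduced /= ba.
Qed.

Lemma reduced_mul u v : reduced v -> reduced (word_mul u v).
Proof. by move=> rv; elim: u => //= a u; exact: reduced_letter_cons. Qed.

Lemma letter_consK a w : reduced w ->
  letter_cons a (letter_cons (letter_inv a) w) = w.
Proof.
case: w => [|b w] /=; first by rewrite eqxx.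
rewrite letter_invK; case: eqVneq => [->|ba] bw /=; last by rewrite eqxx.
case: w bw => [//|c w] /=.
by rewrite /reduced /=; case/andP=> /negPf ->.
Qed.

Lemma word_mul_cons a v w : reduced w ->
  word_mul (letter_cons a v) w = letter_cons a (word_mul v w).
Proof.
case: v => [//|b v] rw /=; case: eqVneq => [->|//].
by rewrite letter_consK //; exact: reduced_mul.
Qed.

Lemma word_mulA u v w : reduced w ->
  word_mul u (word_mul v w) = word_mul (word_mul u v) w.
Proof. by move=> rw; elim: u => //= a u ->; rewrite word_mul_cons. Qed.

Lemma word_mul0 u : reduced u -> word_mul u [::] = u.
Proof.
elim: u => //= a u IH ru; rewrite IH ?(reduced_tl ru) //.
by case: u ru {IH} => //= b u; rewrite /reduced /= => /andP[/negPf ->].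
Qed.

Lemma word_invK : involutive word_inv.
Proof.
by move=> u; rewrite /word_inv map_rev revK -map_comp map_id_in // => a _ /=;
  rewrite letter_invK.
Qed.

Lemma reduced_inv u : reduced u -> reduced (word_inv u).
Proof.
rewrite /reduced /word_inv rev_sorted sorted_map; apply: sub_sorted => a b /=.
by apply: contra => /eqP ->; rewrite letter_invK.
Qed.

Lemma word_mulV u : word_mul (word_inv u) u = [::].
Proof.
elim: u => // a u IH.
rewrite /word_inv /= rev_cons /word_mul foldr_rcons /= letter_invK eqxx.
exact: IH.
Qed.

Definition free_group : Type := {w : seq letter | reduced w}.
HB.instance Definition _ := Choice.on free_group.

Definition fg_one : free_group := exist _ [::] isT.
Definition fg_mul (u v : free_group) : free_group :=
  exist _ (word_mul (val u) (val v)) (reduced_mul (val u) (valP v)).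
Definition fg_inv (u : free_group) : free_group :=
  exist _ (word_inv (val u)) (reduced_inv (valP u)).

Lemma fg_mulA : associative fg_mul.
Proof. by move=> u v w; apply: val_inj; exact: word_mulA (valP w). Qed.
Lemma fg_mul1g : left_id fg_one fg_mul.
Proof. by move=> u; exact: val_inj. Qed.
Lemma fg_mulg1 : right_id fg_one fg_mul.
Proof. by move=> u; apply: val_inj; exact: word_mul0 (valP u). Qed.
Lemma fg_mulVg : left_inverse fg_one fg_inv fg_mul.
Proof. by move=> u; apply: val_inj; exact: word_mulV. Qed.
Lemma fg_mulgV : right_inverse fg_one fg_inv fg_mul.
Proof.
move=> u; apply: val_inj => /=.
by rewrite -{1}(word_invK (val u)) word_mulV.
Qed.

HB.instance Definition _ := isGroup.Build free_group
  fg_mulA fg_mul1g fg_mulg1 fg_mulVg fg_mulgV.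

Definition fg_gen (i : 'I_r) : free_group := exist _ [:: (i, true)] isT.

Definition word_length (g : free_group) : nat := size (val g).

End FreeGroup.

(* Hyperbolic space is the upper sheet of the hyperboloid <x, x> = -1, with
   cosh (d x y) = - <x, y>; the time coordinate comes first. *)

Section Hyperbolic.
Variables (R : realType) (N : nat).

Definition lorentz (x y : 'rV[R]_N.+1) : R :=
  - (x 0 0 * y 0 0) + \sum_(i < N) x 0 (lift ord0 i) * y 0 (lift ord0 i).

Definition hyperbolic : Type :=
  {x : 'rV[R]_N.+1 | (0 < x 0 0) && (lorentz x x == -1)}.

Definition arcosh (t : R) : R := ln (t + Num.sqrt (t ^+ 2 - 1)).

Definition hdist (x y : hyperbolic) : R := arcosh (- lorentz (val x) (val y)).

End Hyperbolic.

Section Hausdorff.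
Variables (R : realType) (Y : Type) (delta : Y -> Y -> R).
Local Open Scope ereal_scope.

(* Adding 0 makes the diameter of the empty set 0. *)
Definition diam (U : set Y) : \bar R :=
  ereal_sup (0 |` [set (delta x y)%:E | x in U & y in U]).

Definition hausdorff_premeasure (s e : R) (E : set Y) : \bar R :=
  ereal_inf [set \sum_(0 <= i <oo) poweR (diam (U i)) s | U in
    [set U : nat -> set Y |
      E `<=` \bigcup_i U i /\ forall i, diam (U i) <= e%:E]].

Definition hausdorff_measure (s : R) (E : set Y) : \bar R :=
  ereal_sup [set hausdorff_premeasure s e E | e in [set e : R | (0 < e)%R]].

Definition Hdim (E : set Y) : \bar R :=
  ereal_inf [set s%:E | s in
    [set s : R | (0 < s)%R /\ hausdorff_measure s E = 0]].

End Hausdorff.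

(* A metric space is given by a carrier [A : set X] and a distance [d] on the
   ambient type [X]; this lets an invariant subtree of the asymptotic cone be
   used as a space in its own right. *)

Section Metric.
Variables (R : realType) (X : Type) (d : X -> X -> R).

Definition gromov_product (o x y : X) : R := (d x o + d y o - d x y) / 2.

Section Boundary.
Variables (A : set X) (o : X).

Definition to_infinity (x : nat -> X) : Prop :=
  (forall n, A (x n)) /\
  (fun p : nat * nat => gromov_product o (x p.1) (x p.2))
    @ filter_prod \oo \oo --> +oo.

(* A boundary point is the set of all sequences of [A] converging to it. *)
Definition boundary_class (x : nat -> X) : set (nat -> X) :=
  [set y | to_infinity y /\
    (fun n => gromov_product o (x n) (y n)) @ \oo --> +oo].

Definition boundary : set (set (nat -> X)) :=
  [set boundary_class x | x in to_infinity].

(* The continuous extension of the Gromov product to the boundary; it is +oo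
   on the diagonal. *)
Definition boundary_gromov (xi zeta : set (nat -> X)) : \bar R :=
  xget 0%E [set l : \bar R | forall x y, xi x -> zeta y ->
    (fun n => (gromov_product o (x n) (y n))%:E) @ \oo --> l].

Definition visual_dist (xi zeta : set (nat -> X)) : R :=
  fine (expeR (- boundary_gromov xi zeta)).

End Boundary.

Section Action.
Variables (n : nat) (rho : free_group n -> X -> X).

(* A representation into Isom(X, d): bijectivity of [rho g] follows from the
   first two conditions. *)
Definition isometric_action : Prop :=
  [/\ forall x, rho 1%g x = x,
      forall g h x, rho (g * h)%g x = rho g (rho h x) &
      forall g x y, d (rho g x) (rho g y) = d x y].

Definition max_displacement (x : X) : R :=
  \big[Num.max/0]_(s < n) d x (rho (fg_gen s) x).

Definition min_joint_displacement : R := inf (range max_displacement).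

Definition schottky (o : X) : Prop :=
  exists K : R, 1 <= K /\ forall g h : free_group n,
    K^-1 * (word_length (g^-1 * h)%g)%:R - K <= d (rho g o) (rho h o) /\
    d (rho g o) (rho h o) <= K * (word_length (g^-1 * h)%g)%:R + K.

Definition limit_set (A : set X) (o : X) : set (set (nat -> X)) :=
  [set xi | boundary A o xi /\
    exists g : nat -> free_group n, xi (fun k => rho (g k) o)].

Definition limit_set_dim (A : set X) (o : X) : \bar R :=
  Hdim (visual_dist o) (limit_set A o).

(* [C] is the carrier of the ambient space. *)
Definition closed_in (C A : set X) : Prop :=
  forall x, C x -> (forall e, 0 < e -> exists2 y, A y & d x y < e) -> A x.

(* In a real tree the geodesic segment from [x] to [y] is the set of [z] such
   that [d x z + d z y = d x y], and the nonempty convex subsets are exactly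
   the subtrees. *)
Definition convex_in (C A : set X) : Prop :=
  forall x y z, A x -> A y -> C z -> d x z + d z y = d x y -> A z.

Definition invariant_set (A : set X) : Prop := forall g x, A x -> A (rho g x).

Definition closed_convex_invariant_subtree (C A : set X) : Prop :=
  [/\ A `<=` C, A !=set0, closed_in C A, convex_in C A & invariant_set A].

Definition minimal_subtree (C A : set X) : Prop :=
  closed_convex_invariant_subtree C A /\
  forall B, closed_convex_invariant_subtree C B -> B `<=` A -> B = A.

End Action.

End Metric.

(* The points of the asymptotic cone of (X, d / r_k, o_k) are the equivalence
   classes, hence sets, of sequences. *)

Section Cone.
Variables (R : realType) (X : Type) (d : X -> X -> R).
Variables (omega : set_system nat) (r : nat -> R) (o : nat -> X).

(* The limit along an ultrafilter always exists in [0, +oo]; it is finite iff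
   there is convergence to a real number. *)
Definition cone_seq (x : nat -> X) : Prop :=
  exists l : R, (fun k => (r k)^-1 * d (x k) (o k)) @ omega --> l.

Definition cone_class (x : nat -> X) : set (nat -> X) :=
  [set y | cone_seq y /\ (fun k => (r k)^-1 * d (x k) (y k)) @ omega --> 0].

Definition cone : set (set (nat -> X)) := [set cone_class x | x in cone_seq].

Definition cone_dist (a b : set (nat -> X)) : R :=
  xget 0 [set l : R | exists x y, [/\ a x, b y &
    (fun k => (r k)^-1 * d (x k) (y k)) @ omega --> l]].

(* On a class all the classes in this union coincide. *)
Definition cone_action (n : nat) (rho : nat -> free_group n -> X -> X)
    (g : free_group n) (a : set (nat -> X)) : set (nat -> X) :=
  \bigcup_(x in a) cone_class (fun k => rho k g (x k)).

End Cone.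

(* Main.v *)
Require Import Defs.
From mathcomp Require Import all_boot all_order all_algebra.
From mathcomp Require Import all_classical all_reals all_analysis.
From mathcomp Require Import ring lra zify.
Import Order.TTheory GRing.Theory Num.Theory.
Import numFieldNormedType.Exports.
Set Implicit Arguments.
Unset Strict Implicit.
Unset Printing Implicit Defensive.
Local Open Scope classical_set_scope.
Local Open Scope ring_scope.

(** Write l_k(g) for the distance from the base point o_k to its image under g,
    divided by r_k, and l(g) for the same distance in the limit tree. Then l_k
    converges to l pointwise along omega. The theorem follows from a much
    stronger comparison: for every eps > 0 and almost all k, the Gromov products
    of orbit points satisfy

      | <g, h>_k - r_k <g, h> | <= eps r_k <g, h> + constant(k)

    for all g and h in the free group (gromov_comparison). Indeed a visual
    distance is the exponential of minus a Gromov product. So the limit points of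
    rho_k and of the limit action correspond to the same sequences of group
    elements, and the correspondence is Hoelder with exponent (1 - eps) r_k in
    one direction and 1 / ((1 + eps) r_k) in the other (limit_set_dim_le). Hoelder
    maps distort Hausdorff dimension by their exponent at most (Hdim_holder), so
    r_k Hdim(k) is squeezed between Hdim / (1 + eps) and Hdim / (1 - eps). The
    constants may depend on k, and the dimensions may be infinite.

    The comparison rests on the almost additivity of lengths on reduced products:
    l(u v) >= l(u) + l(v) - 2C. In a tree, a quasi-isometrically embedded orbit
    has this property with C depending only on the quasi-isometry constant
    (reduced_product_tree_bound). For words of length at most 2m this is a finite
    set of conditions, so it passes to l_k for almost all k. There it propagates
    to words of every length, because the rescaled hyperbolic space is hyperbolic
    with a constant at most 1 (local_to_global). Cutting a word into blocks of m
    letters, on which l_k and l differ by at most 1, bounds the difference of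
    l_k and l by an error of relative size O(1 / m) (length_comparison). Finally
    Gromov products are, up to a constant, lengths of longest common prefixes
    (length_product_branch).

    Two facts about the spaces are needed besides hyperbolicity. The continuous
    extension of Gromov products to the boundary exists; this follows from an
    asymptotic triangle inequality for the exponentials of Gromov products, which
    in the hyperboloid model comes from the chords of the boundary sphere
    (visual_space_hyperbolic), and in the tree from the ultrametric inequality.
    And the base point of the limit lies in the minimal subtree, because it
    minimises the joint displacement, which decreases strictly towards the
    subtree (base_in_subtree). *)

(** * Hausdorff dimension and Hoelder maps *)

Section HausdorffPositivity.
Variables (R : realType) (Z : Type) (dd : Z -> Z -> R).
Local Open Scope ereal_scope.

Lemma diam_ge0 U : 0 <= diam dd U.
Proof. by apply: ereal_sup_ubound; left. Qed.

Lemma hausdorff_premeasure_ge0 s e E :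
  0 <= hausdorff_premeasure dd s e E.
Proof.
apply: le_ereal_inf_tmp => _ [U _ <-]; apply: nneseries_ge0 => n _ _.
exact: poweR_ge0.
Qed.

Lemma Hdim_ge0 E : 0 <= Hdim dd E.
Proof. by apply: le_ereal_inf_tmp => _ [s [s0 _] <-]; rewrite lee_fin ltW. Qed.

End HausdorffPositivity.

Section HolderMaps.
Variables (R : realType) (I Y Y' : Type).
Variables (delta : Y -> Y -> R) (delta' : Y' -> Y' -> R).
Variables (G : set I) (p : I -> Y) (p' : I -> Y') (alpha C : R).
Hypothesis alpha_gt0 : 0 < alpha.
Hypothesis C_gt0 : 0 < C.
Hypothesis delta_ge0 : forall i j, G i -> G j -> 0 <= delta (p i) (p j).
Hypothesis delta_holder : forall i j, G i -> G j ->
  delta' (p' i) (p' j) <= C * delta (p i) (p j) `^ alpha.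

Local Open Scope ereal_scope.

Let transport (U : set Y) : set Y' := p' @` (G `&` p @^-1` U).

Lemma diam_transport U :
  diam delta' (transport U) <= C%:E * poweR (diam delta U) alpha.
Proof.
have h0 : 0 <= C%:E * poweR (diam delta U) alpha.
  by rewrite mule_ge0 ?poweR_ge0// lee_fin ltW.
apply: ge_ereal_sup => _ [->//|[_ [i [Gi Ui] <-] [_ [j [Gj Uj] <-] <-]]].
apply: (@le_trans _ _ (C * delta (p i) (p j) `^ alpha)%:E).
  by rewrite lee_fin delta_holder.
rewrite EFinM -poweR_EFin lee_pmul2l ?lte_fin//.
have le_ij : (delta (p i) (p j))%:E <= diam delta U.
  by apply: ereal_sup_ubound; right; exists (p i) => //; exists (p j).
apply: gt0_ler_poweR => //; first exact: ltW.
- by rewrite in_itv/= lee_fin delta_ge0//= leey.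
- by rewrite in_itv/= diam_ge0 leey.
Qed.

(** Images of the covers of the source cover the target, and the Hoelder bound
    controls the s / alpha powers of their diameters by the s powers of the
    diameters of the original sets. The diameters of a cover of the source are
    arbitrary outside the points indexed by G, hence the transport through the
    index set. *)
Lemma hausdorff_null_holder s : (0 < s)%R ->
  hausdorff_measure delta s (p @` G) = 0 ->
  hausdorff_measure delta' (s / alpha) (p' @` G) = 0.
Proof.
move=> s0 H0.
have sa0 : (0 < s / alpha)%R by rewrite divr_gt0.
apply/eqP; rewrite eq_le; apply/andP; split; last first.
  apply: le_trans (hausdorff_premeasure_ge0 delta' (s / alpha) 1 (p' @` G)) _.
  by apply: ereal_sup_ubound; exists 1%R => //=.
apply: ge_ereal_sup => _ [e' /= e'0 <-].
(* the scale that the Hoelder bound turns into e' *)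
pose e := ((e' / C) `^ alpha^-1)%R.
have e0 : (0 < e)%R by rewrite powR_gt0// divr_gt0.
have eC : (C * e `^ alpha)%R = e'.
  rewrite /e -powRrM mulVf ?gt_eqF// powRr1 ?divr_ge0 ?(ltW e'0) ?(ltW C_gt0)//.
  by rewrite mulrC divfK// gt_eqF.
have pre0 : hausdorff_premeasure delta s e (p @` G) <= 0.
  by rewrite -H0; apply: ereal_sup_ubound; exists e.
apply/lee_addgt0Pr => eta eta0; rewrite add0e.
pose K := (C `^ (s / alpha))%R.
have K0 : (0 < K)%R by rewrite powR_gt0.
have : hausdorff_premeasure delta s e (p @` G) < (eta / K)%:E.
  by apply: le_lt_trans pre0 _; rewrite lte_fin divr_gt0.
move=> /ereal_inf_lt[_ [U [cov diamU] <-]] sumU.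
apply: (@le_trans _ _ (\sum_(0 <= i <oo)
    poweR (diam delta' (transport (U i))) (s / alpha))).
  apply: ereal_inf_lbound; exists (fun i => transport (U i)) => //; split.
    move=> _ [i Gi <-]; have [n _ Un] := cov (p i) (ex_intro2 _ _ i Gi erefl).
    by exists n => //; exists i.
  move=> n; apply: le_trans (diam_transport _) _.
  rewrite -eC EFinM -poweR_EFin lee_pmul2l ?lte_fin//.
  apply: gt0_ler_poweR => //; first exact: ltW.
  - by rewrite in_itv/= diam_ge0 leey.
  - by rewrite in_itv/= leey andbT lee_fin ltW.
apply: (@le_trans _ _ (\sum_(0 <= i <oo)
    (K%:E * poweR (diam delta (U i)) s))).
  apply: lee_nneseries => [i _ _|n _]; first exact: poweR_ge0.
  apply: (@le_trans _ _
      (poweR (C%:E * poweR (diam delta (U n)) alpha) (s / alpha))).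
    apply: gt0_ler_poweR; [exact: ltW| | |exact: diam_transport].
    - by rewrite in_itv/= diam_ge0 leey.
    - by rewrite in_itv/= leey andbT mule_ge0 ?poweR_ge0// lee_fin ltW.
  rewrite poweRM ?poweR_ge0 ?lee_fin ?(ltW C_gt0)// poweR_EFin -poweRrM.
  by rewrite (mulrC alpha) divfK// gt_eqF.
rewrite nneseriesZl; last by move=> i _; exact: poweR_ge0.
apply: (@le_trans _ _ (K%:E * (eta / K)%:E)).
  by rewrite lee_pmul2l ?lte_fin// ltW.
by rewrite -EFinM mulrC divfK// gt_eqF.
Qed.

(** Both sets are images of a common index set, so no map between them has to
    be chosen. *)
Lemma Hdim_holder :
  alpha%:E * Hdim delta' (p' @` G) <= Hdim delta (p @` G).
Proof.
apply: le_ereal_inf_tmp => _ [s [s0 Hs] <-].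
have le_s : Hdim delta' (p' @` G) <= (s / alpha)%:E.
  apply: ereal_inf_lbound; exists (s / alpha)%R => //; split.
    by rewrite divr_gt0.
  exact: hausdorff_null_holder.
apply: (@le_trans _ _ (alpha%:E * (s / alpha)%:E)).
  by rewrite lee_pmul2l ?lte_fin.
by rewrite -EFinM mulrC divfK// gt_eqF.
Qed.

End HolderMaps.

(** * The boundary and its visual distance *)

(** At points of the space this is the quantity whose limit along sequences
    going to infinity is the visual distance. *)
Definition visual (R : realType) (X : Type) (d : X -> X -> R) (o x y : X) : R :=
  expR (- gromov_product d o x y).

(** In a CAT(-1) space the visual quantity satisfies the triangle inequality on
    the boundary only. Between points of the space there is an error that decays
    exponentially with the distance to the base point; this weak form is enough
    to extend Gromov products continuously to the boundary, and it holds both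
    in hyperbolic space and, without error, in a tree. *)
Record visual_space (R : realType) (X : Type) (d : X -> X -> R) (A : set X)
    (o : X) (kappa : R) : Prop := VisualSpace {
  vs_diag : forall x, A x -> d x x = 0;
  vs_sym : forall x y, A x -> A y -> d x y = d y x;
  vs_triangle : forall M x y z, A x -> A y -> A z ->
    M <= d x o -> M <= d y o -> M <= d z o ->
    visual d o x y <= visual d o x z + visual d o z y + kappa * expR (- M) }.

Lemma expRN_cvg0 (R : realType) (u : nat -> R) :
  u @ \oo --> +oo <-> (fun n => expR (- u n)) @ \oo --> (0 : R).
Proof.
split=> [|u0].
  by move=> uoo; exact: (@cvg_comp _ _ _ u (fun t => expR (- t)) _ _ _ uoo
    (@cvgr_expR R)).
apply/cvgryPge => M; have /cvgrPdist_lt/(_ (expR (- M)) (expR_gt0 _)) := u0.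
apply: filterS => n; rewrite sub0r normrN ger0_norm ?expR_ge0// ltr_expR.
by rewrite ltrN2 => /ltW.
Qed.

Lemma to_infinityP (R : realType) (X : Type) (d : X -> X -> R) (A : set X)
    (o : X) (x : nat -> X) :
  to_infinity d A o x <-> (forall n, A (x n)) /\
    forall M, exists N, forall n m, (N <= n)%N -> (N <= m)%N ->
      M <= gromov_product d o (x n) (x m).
Proof.
split=> -[xA xoo]; split=> //.
  move=> M; move/cvgryPge/(_ M) : xoo => -[[P Q] [/= [n1 _ Pn1] [n2 _ Qn2] PQ]].
  exists (maxn n1 n2) => n m; rewrite !geq_max => /andP[n1n _] /andP[_ n2m].
  by apply: (PQ (n, m)); split; [exact: Pn1|exact: Qn2].
apply/cvgryPge => M; have [N HN] := xoo M.
exists ([set n | (N <= n)%N], [set n | (N <= n)%N]).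
  by split; exists N.
by move=> [n m] [/= Nn Nm]; exact: HN.
Qed.

Lemma cvg_ext (T : Type) (V : topologicalType) (F : set_system T) (f g : T -> V)
    (l : V) : f =1 g -> f @ F --> l -> g @ F --> l.
Proof. by move=> /funext ->. Qed.

Lemma expRN_cvg_inv (R : realType) (u : nat -> R) (a : R) :
  (fun n => expR (- u n)) @ \oo --> a ->
  (fun n => (u n)%:E) @ \oo --> (if a == 0 then +oo%E else (- ln a)%:E).
Proof.
move=> ua; have a0 : 0 <= a.
  by apply: (cvgr_to_ge ua); apply: nearW => n; exact: expR_ge0.
case: eqVneq => [az|anz].
  by apply/cvgeryP/expRN_cvg0; rewrite -az.
apply: cvg_EFin; first exact: nearW.
have {}a0 : 0 < a by rewrite lt_neqAle eq_sym anz.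
have la : (fun n => ln (expR (- u n))) @ \oo --> ln a.
  exact: (cvg_comp _ _ ua (continuous_ln a0)).
pose proof (cvgN la) as lNa.
rewrite (_ : fine \o _ = fun n => - ln (expR (- u n)))//.
by apply/funext => n /=; rewrite expRK opprK.
Qed.

Section Boundary.
Variables (R : realType) (X : Type) (d : X -> X -> R) (A : set X) (o : X).
Variable kappa : R.
Hypothesis VS : visual_space d A o kappa.
Implicit Types x y z : nat -> X.

Local Notation v := (visual d o).
Local Notation toinf := (to_infinity d A o).
Local Notation class := (boundary_class d A o).

Lemma visualC a b : A a -> A b -> v a b = v b a.
Proof.
move=> Aa Ab; rewrite /visual /gromov_product (vs_sym VS Aa Ab).
by rewrite (addrC (d a o)).
Qed.

Lemma visual_continuous M a b a' b' : A a -> A b -> A a' -> A b' ->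
  M <= d a o -> M <= d b o -> M <= d a' o -> M <= d b' o ->
  `|v a b - v a' b'| <= v a a' + v b b' + 2 * `|kappa| * expR (- M).
Proof.
move=> Aa Ab Aa' Ab' Ma Mb Ma' Mb'.
have h1 := vs_triangle VS Aa Ab Aa' Ma Mb Ma'.
have h2 := vs_triangle VS Aa' Ab Ab' Ma' Mb Mb'.
have h3 := vs_triangle VS Aa' Ab' Aa Ma' Mb' Ma.
have h4 := vs_triangle VS Aa Ab' Ab Ma Mb' Mb.
have e1 := visualC Aa' Aa; have e2 := visualC Ab' Ab.
have kM : kappa * expR (- M) <= `|kappa| * expR (- M).
  by rewrite ler_wpM2r ?expR_ge0// ler_norm.
by rewrite ler_norml; apply/andP; split; lra.
Qed.

Lemma to_infinity_dist x : toinf x -> (fun n => d (x n) o) @ \oo --> +oo.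
Proof.
move=> /to_infinityP[xA xoo]; apply/cvgryPge => M.
have [N HN] := xoo M; exists N => // n Nn.
have := HN n n Nn Nn; rewrite /gromov_product (vs_diag VS (xA n)) => /=.
by lra.
Qed.

Lemma boundary_class_refl x : toinf x -> class x x.
Proof.
move=> xi; split=> //; apply/cvgryPge => M.
have /to_infinityP[_ /(_ M)[N HN]] := xi.
by exists N => // n Nn; exact: HN.
Qed.

(** Along sequences going to infinity the error term of the asymptotic triangle
    inequality disappears. *)
Lemma boundary_close x x' y y' :
  toinf x -> class x x' -> toinf y -> class y y' ->
  (fun n => v (x n) (y n) - v (x' n) (y' n)) @ \oo --> (0 : R).
Proof.
move=> xi [x'i xx'] yi [y'i yy'].
have [xA _] := xi; have [x'A _] := x'i; have [yA _] := yi; have [y'A _] := y'i.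
apply/cvgrPdist_le => e e0.
have e3 : 0 < e / 3 by rewrite divr_gt0.
pose c := 6 * (`|kappa| + 1) / e.
have c0 : 0 < c by rewrite divr_gt0// mulr_gt0// ltr_wpDl.
move/expRN_cvg0/cvgrPdist_lt/(_ _ e3) : xx' => hx.
move/expRN_cvg0/cvgrPdist_lt/(_ _ e3) : yy' => hy.
move/to_infinity_dist/cvgryPge/(_ (ln c)) : xi => Mx.
move/to_infinity_dist/cvgryPge/(_ (ln c)) : x'i => Mx'.
move/to_infinity_dist/cvgryPge/(_ (ln c)) : yi => My.
move/to_infinity_dist/cvgryPge/(_ (ln c)) : y'i => My'.
apply: filterS (filterI (filterI hx hy)
  (filterI (filterI Mx Mx') (filterI My My'))).
move=> n [] {hx hy Mx Mx' My My'} [hx hy] [[Mx Mx'] [My My']].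
rewrite sub0r normrN in hx; rewrite sub0r normrN in hy.
rewrite sub0r normrN.
rewrite !ger0_norm ?expR_ge0// in hx hy.
apply: le_trans (visual_continuous (xA n) (yA n) (x'A n) (y'A n) Mx My Mx' My') _.
have -> : expR (- ln c) = e / (6 * (`|kappa| + 1)).
  by rewrite expRN lnK ?posrE// /c invf_div.
have -> : 2 * `|kappa| * (e / (6 * (`|kappa| + 1))) =
          e / 3 * (`|kappa| / (`|kappa| + 1)).
  by field; rewrite gt_eqF// ltr_wpDl.
have le1 : `|kappa| / (`|kappa| + 1) <= 1.
  by rewrite ler_pdivrMr ?ltr_wpDl// mul1r lerDl.
have : e / 3 * (`|kappa| / (`|kappa| + 1)) <= e / 3.
  by rewrite ler_piMr// divr_ge0// ltW.
rewrite /visual in hx hy *; lra.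
Qed.

Lemma boundary_class_trans x y z : toinf x -> class x y -> class y z -> class x z.
Proof.
move=> xi xy yz; have [yi _] := xy; have [zi cyz] := yz; split=> //.
apply/expRN_cvg0.
have h := boundary_close xi xy zi (boundary_class_refl zi).
pose proof (cvgD h ((expRN_cvg0 _).1 cyz)) as hh.
rewrite addr0 in hh; refine (cvg_ext _ hh) => n /=.
exact: subrK.
Qed.

Lemma boundary_class_sym x y : toinf x -> class x y -> class y x.
Proof.
move=> xi [yi xy]; split=> //.
have [xA _] := xi; have [yA _] := yi.
rewrite (_ : (fun n => _) = fun n => gromov_product d o (x n) (y n))//.
apply/funext => n; rewrite /gromov_product (vs_sym VS (yA n) (xA n)).
by rewrite (addrC (d (x n) o)).
Qed.

Lemma boundary_class_eq x y : toinf x -> class x y -> class y = class x.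
Proof.
move=> xi xy; have [yi _] := xy; apply/seteqP; split=> z.
  exact: boundary_class_trans.
by apply: boundary_class_trans => //; exact: boundary_class_sym.
Qed.

Lemma visual_cvg x y : toinf x -> toinf y ->
  cvg ((fun n => v (x n) (y n)) @ \oo).
Proof.
move=> xi yi; apply/cauchy_cvgP/cauchyP => e e0 /=.
have [xA xoo] := xi; have [yA yoo] := yi.
pose c := 6 * (`|kappa| + 1) / e.
have c0 : 0 < c by rewrite divr_gt0// mulr_gt0// ltr_wpDl.
have ec : expR (- ln c) = e / (6 * (`|kappa| + 1)).
  by rewrite expRN lnK ?posrE// /c invf_div.
have le1 : `|kappa| / (`|kappa| + 1) < 1.
  by rewrite ltr_pdivrMr ?ltr_wpDl// mul1r ltrDl.
have err : 2 * `|kappa| * expR (- ln c) < e / 3.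
  have -> : 2 * `|kappa| * expR (- ln c) = e / 3 * (`|kappa| / (`|kappa| + 1)).
    by rewrite ec; field; rewrite gt_eqF// ltr_wpDl.
  by rewrite gtr_pMr// divr_gt0.
have /cvgryPge/(_ (ln c))[n1 _ Mx] := to_infinity_dist xi.
have /cvgryPge/(_ (ln c))[n2 _ My] := to_infinity_dist yi.
have [n3 Hx] := ((to_infinityP d A o x).1 xi).2 (- ln (e / 3)).
have [n4 Hy] := ((to_infinityP d A o y).1 yi).2 (- ln (e / 3)).
pose N := maxn (maxn n1 n2) (maxn n3 n4).
have [N1 N2 N3 N4] : [/\ n1 <= N, n2 <= N, n3 <= N & n4 <= N]%N.
  by rewrite /N; split; rewrite !leq_max leqnn ?orbT.
exists (v (x N) (y N)); exists N => // n /= Nn.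
have small a b : - ln (e / 3) <= gromov_product d o a b -> v a b <= e / 3.
  move=> h; rewrite /visual -[leRHS]lnK ?posrE ?divr_gt0//.
  by rewrite ler_expR lerNl.
rewrite /ball/=.
apply: (@le_lt_trans _ _ (v (x N) (x n) + v (y N) (y n)
    + 2 * `|kappa| * expR (- ln c))).
  by apply: visual_continuous => //; [exact: Mx|exact: My|apply: Mx|apply: My];
    apply: leq_trans Nn.
have := small _ _ (Hx N n N3 (leq_trans N3 Nn)).
have := small _ _ (Hy N n N4 (leq_trans N4 Nn)).
by lra.
Qed.

(** The defining limit of the boundary Gromov product exists, because the visual
    quantity is Cauchy along the two sequences and insensitive to the choice of
    representatives. *)
Lemma visual_dist_lim x y : toinf x -> toinf y ->
  (fun n => v (x n) (y n)) @ \oo --> visual_dist d o (class x) (class y).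
Proof.
move=> xi yi; have /cvg_ex[/= a va] := visual_cvg xi yi.
have vcl x' y' : class x x' -> class y y' ->
    (fun n => v (x' n) (y' n)) @ \oo --> a.
  move=> xx' yy'.
  pose proof (cvgB va (boundary_close xi xx' yi yy')) as hh.
  rewrite subr0 in hh; refine (cvg_ext _ hh) => n /=.
  exact: subKr.
pose l : \bar R := if a == 0 then +oo%E else (- ln a)%:E.
have Pl : exists l' : \bar R, forall x' y', class x x' -> class y y' ->
    (fun n => (gromov_product d o (x' n) (y' n))%:E) @ \oo --> l'.
  by exists l => x' y' xx' yy'; exact/expRN_cvg_inv/vcl.
rewrite /visual_dist.
have -> : boundary_gromov d o (class x) (class y) = l.
  apply: (cvg_unique (@ereal_hausdorff R) _ (expRN_cvg_inv va)).
  exact: (xgetPex 0%E Pl _ _ (boundary_class_refl xi) (boundary_class_refl yi)).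
suff -> : fine (expeR (- l)) = a by [].
have a0 : 0 <= a.
  by apply: (cvgr_to_ge va); apply: nearW => n; exact: expR_ge0.
rewrite /l; case: eqVneq => [->//|anz] /=.
by rewrite opprK lnK// posrE lt_neqAle eq_sym anz.
Qed.

(** Limit points are parametrised by sequences of group elements; this is the
    index set through which limit sets of different actions are compared. *)
Lemma limit_setE n (rho : free_group n -> X -> X) :
  limit_set d rho A o = (fun g : nat -> free_group n =>
      class (fun k => rho (g k) o)) @`
    [set g | toinf (fun k => rho (g k) o)].
Proof.
apply/seteqP; split=> [xi [[x xinf <-] [g xg]]|_ [g gi <-]].
  by exists g; [case: xg|exact: boundary_class_eq].
by split; [exists (fun k => rho (g k) o)|
  exists g; exact: boundary_class_refl].
Qed.

End Boundary.

Lemma ler_powR_limit (R : realType) (alpha C : R) (u u' : nat -> R) (a a' : R) :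
  0 < alpha -> 0 < C -> (forall n, 0 <= u n) ->
  (forall n, u' n <= C * u n `^ alpha) ->
  u @ \oo --> a -> u' @ \oo --> a' -> a' <= C * a `^ alpha.
Proof.
move=> al0 C0 u0 uu' ua ua'.
have a0 : 0 <= a by apply: (cvgr_to_ge ua); exact: nearW.
rewrite leNgt; apply/negP => lt_a'.
pose b := (a' / C) `^ alpha^-1.
have Cb : C * b `^ alpha = a'.
  have a'0 : 0 <= a'.
    by apply: le_trans (ltW lt_a'); rewrite mulr_ge0 ?powR_ge0 ?ltW.
  rewrite /b -powRrM mulVf ?gt_eqF// powRr1 ?divr_ge0 ?(ltW C0)//.
  by rewrite mulrC divfK// gt_eqF.
have ab : a < b.
  rewrite ltNge; apply/negP => ba; move: lt_a'; rewrite -Cb ltr_pM2l// ltNge.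
  by rewrite ge0_ler_powR ?nnegrE ?powR_ge0// ltW.
pose t := (a + b) / 2.
have [at_ tb] : a < t /\ t < b by rewrite /t; split; lra.
have t0 : 0 <= t by rewrite (le_trans a0)// ltW.
have : a' <= C * t `^ alpha.
  apply: (ler_cvg_to ua' (cvg_cst _)).
  pose proof (cvgr_lt _ ua _ at_) as near_t; apply: filterS near_t => n unt.
  apply: le_trans (uu' n) _; rewrite ler_pM2l//.
  by rewrite ge0_ler_powR ?nnegrE// ltW.
apply/negP; rewrite -ltNge -Cb ltr_pM2l//.
by rewrite gt0_ltr_powR ?nnegrE// (le_trans t0)// ltW.
Qed.

Section CompareLimitSets.
Variables (R : realType) (n : nat).
Variables (X : Type) (d : X -> X -> R) (A : set X) (o : X) (kappa : R).
Variables (X' : Type) (d' : X' -> X' -> R) (A' : set X') (o' : X') (kappa' : R).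
Variables (rho : free_group n -> X -> X) (rho' : free_group n -> X' -> X').
Hypothesis VS : visual_space d A o kappa.
Hypothesis VS' : visual_space d' A' o' kappa'.
Hypothesis rhoA : forall g, A (rho g o).
Hypothesis rhoA' : forall g, A' (rho' g o').

Local Notation P g h := (gromov_product d o (rho g o) (rho h o)).
Local Notation P' g h := (gromov_product d' o' (rho' g o') (rho' h o')).

(** If the Gromov products along two orbits are comparable up to additive
    constants, the same sequences of group elements converge in both spaces, and
    the lower bound by alpha makes the correspondence of limit points
    alpha-Hoelder. *)
Lemma limit_set_dim_le (alpha beta c c' : R) : 0 < alpha -> 0 < beta ->
  (forall g h, alpha * P g h - c <= P' g h) ->
  (forall g h, beta * P' g h - c' <= P g h) ->
  (alpha%:E * limit_set_dim d' rho' A' o' <= limit_set_dim d rho A o)%E.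
Proof.
move=> al0 be0 PP' P'P; rewrite /limit_set_dim (limit_setE VS) (limit_setE VS').
have infE (g : nat -> free_group n) :
    to_infinity d A o (fun k => rho (g k) o) <->
    to_infinity d' A' o' (fun k => rho' (g k) o').
  split=> /to_infinityP[_ H]; apply/to_infinityP; split=> // M.
    have [N HN] := H ((M + c) / alpha); exists N => i j Ni Nj.
    have := HN i j Ni Nj; rewrite ler_pdivrMr// mulrC => h.
    by apply: le_trans (PP' _ _); rewrite lerBrDr.
  have [N HN] := H ((M + c') / beta); exists N => i j Ni Nj.
  have := HN i j Ni Nj; rewrite ler_pdivrMr// mulrC => h.
  by apply: le_trans (P'P _ _); rewrite lerBrDr.
rewrite (_ : [set g | to_infinity d' _ _ _] =
             [set g | to_infinity d A o (fun k => rho (g k) o)]); last first.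
  by apply/seteqP; split=> g /infE.
apply: (@Hdim_holder _ _ _ _ _ _ _ _ _ _ (expR c)) => //; first exact: expR_gt0.
  move=> g h gi hi; apply: (cvgr_to_ge (visual_dist_lim VS gi hi)).
  by apply: nearW => k; exact: expR_ge0.
move=> g h gi hi.
have gi' := (infE g).1 gi; have hi' := (infE h).1 hi.
apply: (ler_powR_limit al0 (expR_gt0 c) _ _
  (visual_dist_lim VS gi hi) (visual_dist_lim VS' gi' hi')) => k.
  exact: expR_ge0.
rewrite /visual -expRM -expRD ler_expR.
by have := PP' (g k) (h k); lra.
Qed.

End CompareLimitSets.

(** * Reduced words *)

Section Words.
Variable n : nat.
Implicit Types (g h u v w : free_group n) (s t : seq (letter n)).
Local Open Scope group_scope.

(** Absence of cancellation is expressed by lengths alone, so that most facts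
    about it follow from subadditivity. *)
Definition reduced_product u v : Prop :=
  word_length (u * v) = (word_length u + word_length v)%N.

Lemma word_lengthV g : word_length g^-1 = word_length g.
Proof. by rewrite /word_length/= /word_inv size_rev size_map. Qed.

Lemma size_letter_cons (a : letter n) s : (size (letter_cons a s) <= (size s).+1)%N.
Proof. by case: s => //= b s; case: ifP => //= _; lia. Qed.

Lemma word_lengthM g h : (word_length (g * h)%g <= word_length g + word_length h)%N.
Proof.
rewrite /word_length/=; elim: (val g) => //= a s IH.
by apply: leq_trans (size_letter_cons _ _) _; rewrite ltnS.
Qed.

Lemma word_mul_cat s t : reduced (s ++ t) -> word_mul s t = s ++ t.
Proof.
elim: s => //= a s IH r; rewrite IH ?(reduced_tl r)//.
by case: (s ++ t) r => //= b w /andP[/negPf ->].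
Qed.

Lemma reduced_product_cat s t (rst : reduced (s ++ t))
    (rs : reduced s) (rt : reduced t) :
  exist _ (s ++ t) rst = (exist _ s rs : free_group n) * exist _ t rt.
Proof. by apply: val_inj; rewrite /= word_mul_cat. Qed.

Lemma word_split g m : (m <= word_length g)%N ->
  exists u v, [/\ g = u * v, word_length u = m & reduced_product u v].
Proof.
case: g => s rs; rewrite /word_length /= => ms.
have rs' : reduced (take m s ++ drop m s) by rewrite cat_take_drop.
have [rt rd] : reduced (take m s) /\ reduced (drop m s).
  by split; [exact: take_sorted|exact: drop_sorted].
have E : exist _ s rs =
    (exist _ (take m s) rt : free_group n) * exist _ (drop m s) rd.
  rewrite -(reduced_product_cat rs'); apply: val_inj.
  by rewrite /= cat_take_drop.
exists (exist _ (take m s) rt), (exist _ (drop m s) rd); split=> //.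
  by rewrite /word_length/= size_takel.
by rewrite /reduced_product -E /word_length /= -size_cat cat_take_drop.
Qed.

Lemma common_prefix s t : exists p s' t', [/\ s = p ++ s', t = p ++ t' &
  forall a b s1 t1, s' = a :: s1 -> t' = b :: t1 -> a != b].
Proof.
elim: s t => [|a s IH] [|b t].
- by exists [::], [::], [::].
- by exists [::], [::], (b :: t).
- by exists [::], (a :: s), [::].
have [->|ab] := eqVneq a b.
  by have [p [s' [t' [-> -> H]]]] := IH t; exists (b :: p), s', t'.
by exists [::], (a :: s), (b :: t); split=> // ? ? ? ? [<- _] [<- _].
Qed.

Lemma word_branch g h : exists w u v, [/\ g = w * u, h = w * v,
  reduced_product w u, reduced_product w v & reduced_product u^-1 v].
Proof.
case: g h => [s rs] [t rt].
have [p [s' [t' [E1 E2 H]]]] := common_prefix s t; subst s t.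
have rp : reduced p by move: rs; rewrite /reduced => /cat_sorted2[].
have rs' : reduced s' by move: rs; rewrite /reduced => /cat_sorted2[].
have rt' : reduced t' by move: rt; rewrite /reduced => /cat_sorted2[].
exists (exist _ p rp), (exist _ s' rs'), (exist _ t' rt').
have rst : reduced (word_inv s' ++ t'); last first.
  split; rewrite /reduced_product -?reduced_product_cat //;
    by rewrite /word_length/= size_cat.

case: s' t' rs' rt' H {rs rt} => [|a s'] [|b t'] rs' rt' H //.
  by rewrite cats0; exact: reduced_inv.
move: (reduced_inv rs'); rewrite /word_inv /= rev_cons => r.
rewrite -cats1 -catA /= /reduced sorted_cat_cons -/(reduced _) r /=.
by rewrite letter_invK eq_sym (H a b s' t')//; exact: rt'.
Qed.

(** Cancellation between u2 and v would shorten u1 u2 v as well. *)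
Lemma reduced_product_suffix u1 u2 v : reduced_product u1 u2 ->
  reduced_product (u1 * u2) v -> reduced_product u2 v.
Proof.
rewrite /reduced_product => h1 h2.
have := word_lengthM u1 (u2 * v); rewrite mulgA h2 h1.
by have := word_lengthM u2 v; lia.
Qed.

Lemma reduced_product_prefix u v1 v2 : reduced_product v1 v2 ->
  reduced_product u (v1 * v2) -> reduced_product u v1.
Proof.
rewrite /reduced_product => h1 h2.
have := word_lengthM (u * v1) v2; rewrite -mulgA h2 h1.
by have := word_lengthM u v1; lia.
Qed.

Lemma reduced_productV u v : reduced_product u v -> reduced_product v^-1 u^-1.
Proof.
by rewrite /reduced_product -invgM !word_lengthV => ->; rewrite addnC.
Qed.

(** There are finitely many words of bounded length. *)
Lemma near_short_words (F : set_system nat) (FF : Filter F)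
    (P : free_group n -> nat -> Prop) m :
  (forall g, \forall k \near F, P g k) ->
  \forall k \near F, forall g, (word_length g <= m)%N -> P g k.
Proof.
move=> FP.
suff H (Q : seq (letter n) -> nat -> Prop) : (forall s, \forall k \near F, Q s k) ->
    \forall k \near F, forall s, (size s <= m)%N -> Q s k.
  have FQ s : \forall k \near F, forall r : reduced s, P (exist _ s r) k.
    case: (pselect (reduced s)) => [r|nr].
      apply: filterS (FP (exist _ s r)) => k Pk r'.
      by rewrite (bool_irrelevance r' r).
    by apply: nearW => k r.
  by apply: filterS (H _ FQ) => k Hk [s r] /Hk.
elim: m Q => [|m IH] Q FQ.
  by apply: filterS (FQ [::]) => k Qk [].
have Fa : \forall k \near F, forall a : ('I_n * bool)%type, forall s,
    (size s <= m)%N -> Q (a :: s) k.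
  apply: filter_forall => a; exact: IH.
apply: filterS (filterI (FQ [::]) Fa) => k [Q0 Qa] [//|a s] /=.
exact: Qa.
Qed.

Lemma free_group_ind (P : free_group n -> Prop) : P 1 ->
  (forall i g, P g -> P (fg_gen i * g)) ->
  (forall i g, P g -> P ((fg_gen i)^-1 * g)) -> forall g, P g.
Proof.
move=> P1 PM PV [s rs]; elim: s rs => [|[i b] s IH] rs.
  by have -> : exist _ [::] rs = fg_one n by exact: val_inj.
have rt := reduced_tl rs; have ra : reduced [:: (i, b)] by [].
rewrite (@reduced_product_cat [:: (i, b)] s rs ra rt).
case: b rs ra => rs ra.
  have -> : exist _ [:: (i, true)] ra = fg_gen i by exact: val_inj.
  exact: PM.
have -> : exist _ [:: (i, false)] ra = (fg_gen i)^-1 by exact: val_inj.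
exact: PV.
Qed.

End Words.

(** * Hyperbolic length functions on the free group *)

(** The Gromov product of the orbit points of g and h when l g is the distance
    from the base point to its image under g. *)
Definition length_product (R : realType) (n : nat) (l : free_group n -> R)
  (g h : free_group n) : R := (l g + l h - l (g^-1 * h)%g) / 2.

(** By invariance under the group, hyperbolicity of an orbit need only be stated
    at the base point. For delta = 0 the orbit lies in a tree. *)
Record hyperbolic_length (R : realType) (n : nat) (l : free_group n -> R)
    (delta : R) : Prop := HyperbolicLength {
  hl_one : l 1%g = 0;
  hl_inv : forall g, l g^-1%g = l g;
  hl_product : forall g h k,
    Num.min (length_product l g k) (length_product l k h) - delta
      <= length_product l g h }.

Section HyperbolicLength.
Variables (R : realType) (n : nat) (l : free_group n -> R) (delta : R).
Hypothesis hl : hyperbolic_length l delta.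
Implicit Types (g h u v w : free_group n).
Local Notation P := (length_product l).

Lemma length_productC g h : P g h = P h g.
Proof.
rewrite /length_product -(hl_inv hl (g^-1 * h)%g) invgM invgK.
by rewrite (addrC (l g)).
Qed.

Lemma length_product1 g : P 1%g g = 0.
Proof. by rewrite /length_product (hl_one hl) invg1 mul1g add0r subrr mul0r. Qed.

Lemma length_product_diag g : P g g = l g.
Proof. by rewrite /length_product mulVg (hl_one hl) subr0; lra. Qed.

Lemma length_product_geN g h : - delta <= P g h.
Proof.
have := hl_product hl g h 1%g.
by rewrite length_product1 (length_productC g) length_product1 minxx sub0r.
Qed.

Lemma length_mulE u v : l (u * v)%g = l u + l v - 2 * P u^-1%g v.
Proof. by rewrite /length_product invgK (hl_inv hl); lra. Qed.

Lemma length_mul_le u v : l (u * v)%g <= l u + l v + 2 * delta.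
Proof. by rewrite length_mulE; have := length_product_geN u^-1%g v; lra. Qed.

Lemma length_product_le g h : P g h <= l h + delta.
Proof.
have := length_mul_le h (h^-1 * g)%g; rewrite mulgA mulgV mul1g.
by rewrite length_productC /length_product; lra.
Qed.

(** In the triangle 1, u, u v the Gromov products at the two ends of the side
    from 1 to u add up to its length. *)
Lemma length_product_side u v : P (u * v)%g u = l u - P u^-1%g v.
Proof.
rewrite /length_product invgM invgK -mulgA mulVg mulg1 !(hl_inv hl).
by lra.
Qed.

Lemma length_product_side' u v :
  P (u * v)^-1%g v^-1%g = l v - P u^-1%g v.
Proof.
rewrite /length_product !invgK -mulgA mulgV mulg1 !(hl_inv hl).
by lra.
Qed.

Lemma length_product_max C g h k : P g h <= C -> C + delta < P g k ->
  P k h <= C + delta.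
Proof.
move=> h1 h2; have := hl_product hl g h k.
by rewrite lerBlDr ge_min => /orP[]; lra.
Qed.

(** Almost additivity of l on reduced products is a local property. In the
    triangle with vertices u^-1, 1, v cut the last m letters u2 off u. By
    induction the path from 1 to u^-1 almost passes through u2^-1, so the Gromov
    product of these two is about l u2, which is large. Hyperbolicity then carries
    the local bound for u2^-1 and v over to u^-1 and v. A second induction does
    the same on the side of v. *)
Lemma local_to_global (m : nat) (C : R) : (0 < m)%N -> 0 <= delta ->
  (forall u v, reduced_product u v -> (word_length u <= m)%N ->
     (word_length v <= m)%N -> P u^-1%g v <= C) ->
  (forall u, word_length u = m -> 2 * C + 4 * delta < l u) ->
  forall u v, reduced_product u v -> P u^-1%g v <= C + 2 * delta.
Proof.
move=> m0 d0 loc long.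
have short u v : reduced_product u v -> (word_length v <= m)%N ->
    P u^-1%g v <= C + delta.
  have [k] := ubnP (word_length u); elim: k u v => // k IH u v ku uv vm.
  have [um|mu] := leqP (word_length u) m.
    by apply: le_trans (loc _ _ uv um vm) _; rewrite lerDl.
  have [u1 [u2 [E u1m u12]]] := word_split (leq_subr m (word_length u)).
  subst u.
  have u2m : word_length u2 = m.
    by move: u12 mu u1m; rewrite /reduced_product; lia.
  have u2v := reduced_product_suffix u12 uv.
  apply: (length_product_max (g := u2^-1%g)).
    by apply: loc => //; rewrite u2m.
  rewrite length_productC length_product_side'.
  have := IH u1 u2 _ u12 _; have := long _ u2m.
  have : (word_length u1 < k)%N by move: ku u1m mu; lia.
  by rewrite u2m => h1 h2 /(_ h1 (leqnn _)); lra.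
move=> u v; have [k] := ubnP (word_length v).
elim: k u v => // k IH u v kv uv.
have [vm|mv] := leqP (word_length v) m.
  by apply: le_trans (short _ _ uv vm) _; lra.
have [v1 [v2 [E v1m v12]]] := word_split (ltnW mv); subst v.
have uv1 := reduced_product_prefix v12 uv.
rewrite length_productC (_ : C + 2 * delta = C + delta + delta); last by lra.
apply: (length_product_max (g := v1)).
  by rewrite length_productC; apply: short => //; rewrite v1m.
rewrite length_productC length_product_side.
have := IH v1 v2 _ v12; have := long _ v1m.
have : (word_length v2 < k)%N.
  by move: kv v12 v1m; rewrite /reduced_product; lia.
by move=> h1 h2 /(_ h1); lra.
Qed.

(** The Gromov product of two group elements is, up to a constant, the length
    of their longest common prefix. *)
Lemma length_product_branch (C : R) : 0 <= C ->
  (forall u v, reduced_product u v -> P u^-1%g v <= C) ->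
  forall w u v, reduced_product w u -> reduced_product w v ->
    reduced_product u^-1%g v ->
  `|P (w * u)%g (w * v)%g - l w| <= 2 * C + 2 * `|delta|.
Proof.
move=> C0 red w u v wu wv uv.
rewrite /length_product (_ : ((w * u)^-1 * (w * v) = u^-1 * v)%g); last first.
  by rewrite invgM -mulgA (mulgA w^-1%g) mulVg mul1g.
rewrite !length_mulE invgK (hl_inv hl).
have := red _ _ wu; have := red _ _ wv; have := red _ _ uv.
rewrite invgK.
have := length_product_geN w^-1%g u.
have := length_product_geN w^-1%g v.
have := length_product_geN u v.
have := ler_norm delta; have := normr_ge0 delta.
by rewrite ler_norml => *; apply/andP; split; lra.
Qed.

End HyperbolicLength.

Section QuasiIsometricLength.
Variables (R : realType) (n : nat) (l : free_group n -> R) (K : R).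
Hypothesis hl : hyperbolic_length l 0.
Hypothesis K1 : 1 <= K.
Hypothesis qi : forall g : free_group n,
  K^-1 * (word_length g)%:R - K <= l g /\ l g <= K * (word_length g)%:R + K.
Implicit Types (g h u v w : free_group n).
Local Notation P := (length_product l).

Let K0 : 0 < K. Proof. exact: lt_le_trans K1. Qed.

Lemma word_length_le g : (word_length g)%:R <= K * l g + K ^+ 2.
Proof.
have [h _] := qi g; rewrite -(ler_pM2l (_ : 0 < K^-1)) ?invr_gt0//.
by rewrite mulrDr mulKf ?gt_eqF// expr2 mulKf ?gt_eqF//; lra.
Qed.

(** Take a prefix v1 whose Gromov product with v is at least t while that of the
    previous prefix is not. In a tree the step between the two passes through
    the point at height t of the segment from 1 to v, and it has length at most
    2K. *)
Lemma exit_vertex v (t : R) : 0 < t -> t <= l v ->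
  exists v1 v2, [/\ v = (v1 * v2)%g, reduced_product v1 v2, t <= P v1 v &
    l v1 <= t + 2 * K].
Proof.
move=> t0 tv.
suff H m : forall v1 v2, v = (v1 * v2)%g -> reduced_product v1 v2 ->
    word_length v1 = m -> t <= P v1 v ->
    exists v1 v2, [/\ v = (v1 * v2)%g, reduced_product v1 v2, t <= P v1 v &
    l v1 <= t + 2 * K].
  apply: (H _ v 1%g) => //; first by rewrite mulg1.
    by rewrite /reduced_product mulg1 addn0.
  by rewrite (length_product_diag hl).
elim: m => [|m IH] v1 v2 E v12 v1m tP.
  have v1E : v1 = 1%g by apply: val_inj; exact: size0nil v1m.
  by move: tP; rewrite v1E (length_product1 hl) leNgt t0.
have [w [s [Ew wm ws]]] : exists w s, [/\ v1 = (w * s)%g, word_length w = m &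
    reduced_product w s] by apply: word_split; rewrite v1m.
have s1 : word_length s = 1%N.
  by move: ws; rewrite /reduced_product -Ew v1m wm; lia.
have [tw|wt] := leP t (P w v).
  apply: (IH w (s * v2)%g) => //; first by rewrite mulgA -Ew.
  rewrite /reduced_product mulgA -Ew v12 v1m wm.
  have -> : word_length (s * v2)%g = (word_length s + word_length v2)%N.
    by apply: (reduced_product_suffix ws); rewrite -Ew.
  by rewrite s1; lia.
exists v1, v2; split=> //.
have := hl_product hl w v v1; rewrite subr0 => h.
have wv1 : P w v1 < t.
  by move: h; rewrite ge_min => /orP[h|h]; lra.
move: wv1; rewrite /length_product Ew mulgA mulVg mul1g -Ew.
have := length_mul_le hl w s; rewrite -Ew.
have [_] := qi s; rewrite s1; lra.
Qed.

(** Stability of quasi-geodesics in a tree. If the Gromov product is t, the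
    paths from 1 to u^-1 and to v have vertices x1 and v1 within 2K of the
    branch point at height t. These are within 4K of each other, so x1^-1 v1 has
    bounded word length, and since it is reduced v1 is bounded too, and with it
    t. *)
Lemma reduced_product_tree_bound u v : reduced_product u v ->
  P u^-1%g v <= 5 * K ^+ 3 + K.
Proof.
move=> uv; set t := P _ _; rewrite leNgt; apply/negP => ht.
have t0 : 0 < t.
  apply: le_lt_trans ht; rewrite addr_ge0 ?(ltW K0)// mulr_ge0 ?exprn_ge0//.
  exact: ltW.
have tv : t <= l v by have := length_product_le hl u^-1%g v; rewrite addr0.
have tu : t <= l u^-1%g.
  by have := length_product_le hl v u^-1%g; rewrite addr0 (length_productC hl).
have [v1 [v2 [Ev v12 tv1 lv1]]] := exit_vertex t0 tv.
have [x1 [x2 [Ex x12 tx1 lx1]]] := exit_vertex t0 tu.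
have x1v1 : reduced_product x1^-1%g v1.
  apply: (@reduced_product_prefix _ _ v1 v2) => //; rewrite -Ev.
  apply: (@reduced_product_suffix _ x2^-1%g); first exact: reduced_productV.
  by rewrite -invgM -Ex invgK.
have h1 : t <= P x1 v1.
  have := hl_product hl x1 v u^-1%g; have := hl_product hl x1 v1 v.
  rewrite !subr0 -/t => h2 h3.
  apply: le_trans h2; rewrite le_min (length_productC hl v) tv1 andbT.
  by apply: le_trans h3; rewrite le_min tx1 lexx.
have := word_length_le (x1^-1 * v1)%g.
rewrite x1v1 natrD.
have dist : l (x1^-1 * v1)%g <= 4 * K by move: h1; rewrite /length_product; lra.
have v1le := length_product_le hl v1 v; rewrite (length_productC hl) addr0 in v1le.
have v1t : t <= l v1.
  by have := length_product_le hl v v1; rewrite addr0 (length_productC hl); lra.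
have [_ qv1] := qi v1.
have x1p : 0 <= (word_length x1^-1%g)%:R :> R by exact: ler0n.
have : K * l (x1^-1 * v1)%g <= K * (4 * K) by rewrite ler_pM2l.
move=> h2 h3.
have h4 : (word_length v1)%:R <= 5 * K ^+ 2 by rewrite expr2 in h3 *; lra.
have : K * (word_length v1)%:R <= K * (5 * K ^+ 2) by rewrite ler_pM2l.
move: ht; rewrite !exprS expr0; lra.
Qed.

End QuasiIsometricLength.

Section Comparison.
Variables (R : realType) (n : nat) (l l' : free_group n -> R).
Variables (delta C : R) (m : nat).
Hypothesis hl : hyperbolic_length l 0.
Hypothesis hl' : hyperbolic_length l' delta.
Hypothesis delta1 : 0 <= delta <= 1.
Hypothesis C0 : 0 <= C.
Hypothesis m0 : (0 < m)%N.
Hypothesis red : forall u v : free_group n, reduced_product u v ->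
  length_product l u^-1%g v <= C.
Hypothesis red' : forall u v : free_group n, reduced_product u v ->
  length_product l' u^-1%g v <= C.
Hypothesis close : forall g : free_group n, (word_length g <= m)%N ->
  `|l' g - l g| <= 1.
Let E : R := 2 * C + 3.

(** Each of the blocks of m letters contributes a bounded error. *)
Lemma length_close_linear (g : free_group n) :
  `|l' g - l g| <= E * ((word_length g)%:R / m%:R + 1).
Proof.
have C0' := C0; have delta1' := delta1.
have [k] := ubnP (word_length g); elim: k g => // k IH g kg.
have mR : 0 < m%:R :> R by rewrite ltr0n.
have [gm|mg] := leqP (word_length g) m.
  apply: le_trans (close gm) _.
  have h : 0 <= (word_length g)%:R / m%:R :> R by rewrite divr_ge0// ler0n.
  have : 0 <= E * ((word_length g)%:R / m%:R) by rewrite mulr_ge0// /E; lra.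
  by rewrite mulrDr mulr1 /E; lra.
have [u [v [Eg um uv]]] := word_split (ltnW mg); subst g.
have vk : (word_length v < k)%N.
  by move: kg um uv; rewrite /reduced_product; lia.
have := IH v vk; have := close (eq_leq um).
have := red uv; have := red' uv.
have := length_product_geN hl u^-1%g v; have := length_product_geN hl' u^-1%g v.
rewrite (length_mulE hl) (length_mulE hl') uv um natrD.
rewrite (_ : (m%:R + (word_length v)%:R) / m%:R = 1 + (word_length v)%:R / m%:R).
  rewrite !mulrDr !mulr1; move: (E * _) => X; rewrite /E.
  rewrite !ler_norml => ? ? ? ? /andP[? ?] /andP[? ?].
  by case/andP: delta1' => ? ?; apply/andP; split; lra.
by rewrite mulrDl divff// gt_eqF.
Qed.

End Comparison.

(** The error per block of m letters is bounded independently of m, while a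
    block has length about m / K at least. Hence a large m makes the relative
    error small, and how large depends only on K and eps. *)
Lemma length_comparison (R : realType) (n : nat) (l : free_group n -> R)
    (K eps : R) :
  hyperbolic_length l 0 -> 1 <= K ->
  (forall g : free_group n, K^-1 * (word_length g)%:R - K <= l g /\
     l g <= K * (word_length g)%:R + K) ->
  0 < eps ->
  exists m, forall (l' : free_group n -> R) (delta : R),
    hyperbolic_length l' delta -> 0 <= delta <= 1 ->
    (forall g, (word_length g <= m)%N -> `|l' g - l g| <= 1) ->
    exists c, forall g h, `|length_product l' g h - length_product l g h|
      <= eps * length_product l g h + c.
Proof.
move=> hl K1 qi eps0.
have K0 : 0 < K by exact: lt_le_trans K1.
pose C := 5 * K ^+ 3 + K + 2.
have C2 : 2 <= C.
  have : 0 <= 5 * K ^+ 3 by rewrite mulr_ge0// exprn_ge0// ltW.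
  by rewrite /C; lra.
pose E := 2 * (C + 2) + 3.
have E0 : 0 < E by rewrite /E; lra.
(* the first summand makes the blocks long enough for local_to_global, the
   second makes the relative error at most eps *)
pose m := (Num.truncn (K * (2 * C + 5 + K) + E * K / eps)).+1.
have mbig : K * (2 * C + 5 + K) + E * K / eps < m%:R.
  exact: Num.Theory.truncnS_gt.
have EK0 : 0 < E * K / eps by rewrite divr_gt0// mulr_gt0.
have KC0 : 0 < K * (2 * C + 5 + K).
  by rewrite mulr_gt0//; move: C2 K0; move: (C) => c; lra.
have m0 : 0 < m%:R :> R by rewrite ltr0n.
exists (m + m)%N => l' delta hl' delta1 close.
have /andP[d0 d1] := delta1.
have red (u v : free_group n) : reduced_product u v ->
    length_product l u^-1%g v <= C - 2.
  by rewrite /C addrK; exact: reduced_product_tree_bound.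
have red' (u v : free_group n) : reduced_product u v ->
    length_product l' u^-1%g v <= C + 2 * delta.
  apply: (local_to_global hl' (m := m)) => // [{}u {}v uv um vm|{}u um].
    have := red u v uv; rewrite /length_product invgK.
    have hu := close _ (leq_trans (um : (word_length u <= m)%N) (leq_addr m m)).
    have hv := close _ (leq_trans (vm : (word_length v <= m)%N) (leq_addr m m)).
    have huv : `|l' (u * v)%g - l (u * v)%g| <= 1.
      by apply: close; rewrite uv leq_add.
    move: hu hv huv; rewrite (hl_inv hl) (hl_inv hl') !ler_norml.
    by move=> /andP[? ?] /andP[? ?] /andP[? ?]; lra.
  have := close u; rewrite um leq_addr => /(_ isT); rewrite ler_norml => /andP[? _].
  have [+ _] := qi u; rewrite um.
  have : 2 * C + 5 + K < K^-1 * m%:R.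
    by rewrite -(ltr_pM2l K0) mulVKf ?gt_eqF//; lra.
  lra.
have lin (g : free_group n) : `|l' g - l g| <= E * ((word_length g)%:R / m%:R + 1).
  apply: (length_close_linear hl hl' delta1 (C := C + 2)) => //.
  - lra.
  - by move=> u v uv; have := red u v uv; lra.
  - by move=> u v uv; have := red' u v uv; lra.
  - by move=> h hm; apply: close; rewrite (leq_trans hm)// leq_addr.
pose B := 2 * (C + 2) + 2.
exists (E * ((K * B + K ^+ 2) / m%:R + 1) + 2 * B) => g h.
have [w [u [v [-> -> wu wv uv]]]] := word_branch g h.
have b1 : `|length_product l (w * u)%g (w * v)%g - l w| <= B.
  have C20 : 0 <= C - 2 by lra.
  apply: le_trans (length_product_branch hl C20 red wu wv uv) _.
  by rewrite normr0 mulr0 addr0 /B; lra.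
have b2 : `|length_product l' (w * u)%g (w * v)%g - l' w| <= B.
  have C20 : 0 <= C + 2 * delta by lra.
  apply: le_trans (length_product_branch hl' C20 red' wu wv uv) _.
  by rewrite ger0_norm// /B; lra.
have b3 := lin w.
have b4 := word_length_le K1 qi w.
have p0 := length_product_geN hl (w * u)%g (w * v)%g; rewrite oppr0 in p0.
set p := length_product l _ _ in p0 b1 *; set p' := length_product l' _ _ in b2 *.
have b5 : (word_length w)%:R <= K * p + (K * B + K ^+ 2).
  apply: le_trans b4 _; rewrite addrA lerD2r -mulrDr ler_pM2l//.
  by move: b1; rewrite ler_norml => /andP[? ?]; lra.
have b6 : E * ((word_length w)%:R / m%:R + 1) <=
    eps * p + E * ((K * B + K ^+ 2) / m%:R + 1).
  have b7 : E * K / m%:R <= eps.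
    by rewrite ler_pdivrMr// (mulrC eps) -ler_pdivrMr//; lra.
  apply: (@le_trans _ _ (E * ((K * p + (K * B + K ^+ 2)) / m%:R + 1))).
    by rewrite ler_pM2l// lerD2r ler_pM2r// invr_gt0.
  apply: (@le_trans _ _ (E * K / m%:R * p + E * ((K * B + K ^+ 2) / m%:R + 1))).
    by rewrite le_eqVlt; apply/orP; left; apply/eqP; field; rewrite gt_eqF.
  by rewrite lerD2r ler_wpM2r.
have {b6} b3 := le_trans b3 b6.
set Y := E * _ in b3 *; move: b1 b2 b3.
rewrite !ler_norml => /andP[? ?] /andP[? ?] /andP[? ?].
by apply/andP; split; lra.
Qed.

(** * Hyperbolic space *)

Lemma discriminant_le0 (R : realFieldType) (a s b : R) : 0 <= a ->
  (forall t, 0 <= t ^+ 2 * a + 2 * t * s + b) -> s ^+ 2 <= a * b.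
Proof.
rewrite le_eqVlt => /orP[/eqP <-|a0] H.
  rewrite mul0r; have [->|s0] := eqVneq s 0; first by rewrite expr0n.
  have := H (- (b + 1) / (2 * s)); rewrite mulr0 add0r.
  have -> : 2 * (- (b + 1) / (2 * s)) * s + b = - 1 by field.
  by rewrite ler0N1.
rewrite -subr_ge0 (_ : _ - _ = a * ((- s / a) ^+ 2 * a + 2 * (- s / a) * s + b)).
  by rewrite mulr_ge0// ltW.
by field; rewrite gt_eqF.
Qed.

Section Lorentz.
Variables (R : realType) (N : nat).
Implicit Types u v w : 'rV[R]_N.+1.
Local Notation L := (@lorentz R N).

Lemma lorentzC u v : L u v = L v u.
Proof.
rewrite /lorentz mulrC; congr (_ + _).
by apply: eq_bigr => i _; rewrite mulrC.
Qed.

Lemma lorentzDl u v w : L (u + v) w = L u w + L v w.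
Proof.
rewrite /lorentz !mxE mulrDl opprD -!addrA; congr (_ + _).
rewrite addrCA; congr (_ + _); rewrite -big_split /=.
by apply: eq_bigr => i _; rewrite !mxE mulrDl.
Qed.

Lemma lorentzZl a u v : L (a *: u) v = a * L u v.
Proof.
rewrite /lorentz !mxE mulrDr mulrN mulrA; congr (_ + _).
by rewrite mulr_sumr; apply: eq_bigr => i _; rewrite !mxE mulrA.
Qed.

Lemma lorentzDr u v w : L w (u + v) = L w u + L w v.
Proof. by rewrite lorentzC lorentzDl !(lorentzC w). Qed.

Lemma lorentzZr a u v : L v (a *: u) = a * L v u.
Proof. by rewrite lorentzC lorentzZl (lorentzC v). Qed.

Lemma lorentzNl u v : L (- u) v = - L u v.
Proof. by rewrite -scaleN1r lorentzZl mulN1r. Qed.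

Lemma lorentzNr u v : L v (- u) = - L v u.
Proof. by rewrite lorentzC lorentzNl (lorentzC v). Qed.

Definition lorentzE :=
  (lorentzDl, lorentzDr, lorentzNl, lorentzNr, lorentzZl, lorentzZr).

Local Notation D u v := (\sum_(i < N) u 0 (lift ord0 i) * v 0 (lift ord0 i)).

Lemma space_cauchy_schwarz u v : (D u v) ^+ 2 <= D u u * D v v.
Proof.
apply: discriminant_le0 => [|t].
  by apply: sumr_ge0 => i _; rewrite -expr2 sqr_ge0.
rewrite (_ : _ + _ = \sum_(i < N) (t * u 0 (lift ord0 i) + v 0 (lift ord0 i)) ^+ 2).
  by apply: sumr_ge0 => i _; exact: sqr_ge0.
rewrite !mulr_sumr -!big_split /=; apply: eq_bigr => i _.
by rewrite !expr2; ring.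
Qed.

Lemma lorentz_orth_ge0 v w : L w w < 0 -> L v w = 0 -> 0 <= L v v.
Proof.
rewrite /lorentz => ww /eqP; rewrite addrC subr_eq0 => /eqP vw.
have := space_cauchy_schwarz v w; rewrite vw.
have : 0 <= D v v by apply: sumr_ge0 => i _; rewrite -expr2 sqr_ge0.
have : 0 <= D w w by apply: sumr_ge0 => i _; rewrite -expr2 sqr_ge0.
move: (D v v) (D w w) ww {vw} => V W ww W0 V0 cs.
have w0 : 0 < w 0 0 * w 0 0 by lra.
rewrite addrC subr_ge0 -(ler_pM2r w0).
apply: (@le_trans _ _ (V * W)); last by rewrite ler_wpM2l//; lra.
by apply: le_trans cs; rewrite le_eqVlt; apply/orP; left; apply/eqP; ring.
Qed.

Lemma lorentz_cauchy_schwarz u v w : L w w < 0 -> L u w = 0 -> L v w = 0 ->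
  L u v ^+ 2 <= L u u * L v v.
Proof.
move=> ww uw vw; apply: discriminant_le0 => [|t].
  exact: lorentz_orth_ge0 uw.
rewrite (_ : _ + _ = L (t *: u + v) (t *: u + v)).
  by apply: (lorentz_orth_ge0 ww); rewrite !lorentzE uw vw mulr0 addr0.
by rewrite !lorentzE (lorentzC v u); ring.
Qed.

End Lorentz.

Section HyperbolicMetric.
Variables (R : realType) (N : nat).
Local Notation H := (hyperbolic R N).
Implicit Types x y z w : H.
Local Notation L := (@lorentz R N).
Local Notation d := (@hdist R N).
Local Notation B x y := (- L (val x) (val y)).

Lemma hyperbolic_norm x : L (val x) (val x) = -1.
Proof. by have /andP[_ /eqP] := valP x. Qed.

Lemma cosh_ge1 x y : 1 <= B x y.
Proof.
have := hyperbolic_norm x; have := hyperbolic_norm y.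
have /andP[x0 _] := valP x; have /andP[y0 _] := valP y.
have := space_cauchy_schwarz (val x) (val y).
have : 0 <= \sum_(i < N) val x 0 (lift ord0 i) * val x 0 (lift ord0 i).
  by apply: sumr_ge0 => i _; rewrite -expr2 sqr_ge0.
have : 0 <= \sum_(i < N) val y 0 (lift ord0 i) * val y 0 (lift ord0 i).
  by apply: sumr_ge0 => i _; rewrite -expr2 sqr_ge0.
rewrite /lorentz.
move: (\sum_(i < N) _) (\sum_(i < N) _) (\sum_(i < N) _).
move: (val x 0 0) (val y 0 0) x0 y0 => a b a0 b0 D X Y Y0 X0 cs Yb Xa.
have a1 : 1 <= a.
  rewrite leNgt; apply/negP => lt1.
  by have := mulr_ilt1 (ltW a0) (ltW a0) lt1 lt1; lra.
have b1 : 1 <= b.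
  rewrite leNgt; apply/negP => lt1.
  by have := mulr_ilt1 (ltW b0) (ltW b0) lt1 lt1; lra.
have ab1 : 1 <= a * b by rewrite -[leLHS]mulr1 ler_pM.
suff : D <= a * b - 1 by lra.
rewrite leNgt; apply/negP => Dgt.
have : (a * b - 1) ^+ 2 < D ^+ 2 by rewrite ltr_pXn2r// nnegrE; lra.
have -> : (a * b - 1) ^+ 2 = X * Y + (a - b) ^+ 2.
  have -> : X = a * a - 1 by lra.
  have -> : Y = b * b - 1 by lra.
  by ring.
by have := sqr_ge0 (a - b); lra.
Qed.

Lemma expR_hdist x y : expR (d x y) = B x y + Num.sqrt (B x y ^+ 2 - 1).
Proof.
rewrite /hdist /arcosh lnK// posrE ltr_wpDr ?sqrtr_ge0//.
by apply: lt_le_trans (cosh_ge1 x y).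
Qed.

Lemma cosh_hdist x y : expR (d x y) + expR (- d x y) = 2 * B x y.
Proof.
have b1 := cosh_ge1 x y.
have s2 : Num.sqrt (B x y ^+ 2 - 1) ^+ 2 = B x y ^+ 2 - 1.
  by rewrite sqr_sqrtr// subr_ge0 expr_ge1//; lra.
have e0 := expR_gt0 (d x y).
rewrite expRN; apply: (mulfI (lt0r_neq0 e0)).
rewrite mulrDr divff ?lt0r_neq0// expR_hdist.
by rewrite -expr2 sqrrD s2; ring.
Qed.

Lemma hdist_ge0 x y : 0 <= d x y.
Proof.
rewrite -ler_expR expR0 expR_hdist; have := cosh_ge1 x y.
by have := sqrtr_ge0 (B x y ^+ 2 - 1); lra.
Qed.

Lemma cosh_le_expR x y : B x y <= expR (d x y) <= 2 * B x y.
Proof.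
apply/andP; split; first by rewrite expR_hdist lerDl sqrtr_ge0.
by rewrite -cosh_hdist lerDl expR_ge0.
Qed.

Lemma hdistxx x : d x x = 0.
Proof.
by rewrite /hdist /arcosh hyperbolic_norm opprK expr1n subrr sqrtr0 addr0 ln1.
Qed.

Lemma hdistC x y : d x y = d y x.
Proof. by rewrite /hdist lorentzC. Qed.

(** Evaluating the Lorentz form on the combination of x, y and z that is
    orthogonal to w, which is spacelike, gives a quasi-Ptolemaic inequality
    between the hyperbolic cosines of the six distances; its logarithm is the
    hyperbolicity of the space. *)
Lemma cosh_ptolemy x y z w :
  B x y * B z w <= 2 * (B x z * B y w + B y z * B x w).
Proof.
have a1 := cosh_ge1 x w; have b1 := cosh_ge1 y w; have c1 := cosh_ge1 z w.
pose a := B x w; pose b := B y w; pose c := B z w.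
pose v := (b * c) *: val x + ((a * c) *: val y + (- 2 * (a * b)) *: val z).
have vw : L v (val w) = 0.
  by rewrite !lorentzE /a /b /c; ring.
have ww : L (val w) (val w) < 0 by rewrite hyperbolic_norm ltrN10.
have := lorentz_orth_ge0 ww vw.
rewrite !lorentzE !hyperbolic_norm (lorentzC (val y) (val x)).
rewrite (lorentzC (val z) (val x)) (lorentzC (val z) (val y)).
move: a1 b1 c1; rewrite -/a -/b -/c => a1 b1 c1 h.
have abc : 0 < 2 * (a * b * c).
  move: a1 b1 c1; clear; clearbody a b c => a1 b1 c1.
  by rewrite !mulr_gt0//; lra.
rewrite -(ler_pM2l abc) -subr_ge0; apply: le_trans h _.
rewrite -subr_ge0.
rewrite (_ : _ - _ = (b * c) ^+ 2 + (a * c) ^+ 2 + 4 * (a * b) ^+ 2); last by ring.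
by have := sqr_ge0 (b * c); have := sqr_ge0 (a * c); have := sqr_ge0 (a * b); lra.
Qed.


Lemma hyperbolic_product x y z w :
  Num.min (gromov_product d w x z) (gromov_product d w z y) - ln 16
    <= gromov_product d w x y.
Proof.
have main (X Y : R) : B x z * B y w <= expR X -> B y z * B x w <= expR X ->
    d x y + d z w <= ln 16 + X.
  move=> h1 h2; rewrite -ler_expR !expRD lnK ?posrE//.
  have /andP[b1 e1] := cosh_le_expR x y; have /andP[b2 e2] := cosh_le_expR z w.
  have c1 := cosh_ge1 x y; have c2 := cosh_ge1 z w.
  apply: (@le_trans _ _ ((2 * B x y) * (2 * B z w))).
    exact: ler_pM (expR_ge0 _) (expR_ge0 _) e1 e2.
  move: (cosh_ptolemy x y z w) h1 h2.
  move: (B x y) (B z w) (B x z * B y w) (B y z * B x w) (expR X).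
  by clear => p q r1 r2 e; lra.
have pr x1 y1 z1 w1 : B x1 y1 * B z1 w1 <= expR (d x1 y1 + d z1 w1).
  have /andP[b1 _] := cosh_le_expR x1 y1; have /andP[b2 _] := cosh_le_expR z1 w1.
  have c1 := cosh_ge1 x1 y1; have c2 := cosh_ge1 z1 w1.
  rewrite expRD; apply: (ler_pM _ _ b1 b2); first exact: le_trans c1.
  exact: le_trans c2.
have l16 : 0 <= ln 16 :> R by rewrite ln_ge0// ler1n.
rewrite /gromov_product (hdistC z y) lerBlDr ge_min.
have [h|h] := leP (d x z + d y w) (d y z + d x w).
  have := main (d y z + d x w) 0 (le_trans (pr _ _ _ _) _) (pr _ _ _ _).
  by rewrite ler_expR => /(_ h) ?; apply/orP; right; lra.
have := main (d x z + d y w) 0 (pr _ _ _ _) (le_trans (pr _ _ _ _) _).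
by rewrite ler_expR => /(_ (ltW h)) ?; apply/orP; left; lra.
Qed.

(** The points of the segment from x to y are the normalised combinations of
    x and y, and exponentials of distances are Lorentz products up to a factor
    2, so giving y the weight e^(2t - d) yields a point near distance t. *)
Lemma rough_geodesic x y (t : R) : 0 <= t <= d x y ->
  exists z, `|d x z - t| <= ln 4 /\ `|d z y - (d x y - t)| <= ln 4.
Proof.
move=> /andP[t0 td].
have [u hu] : {u | u = expR t} by exists (expR t).
have [E hE] : {E | E = expR (d x y)} by exists (expR (d x y)).
have u1 : 1 <= u by rewrite hu -expR0 ler_expR.
have uE : u <= E by rewrite hu hE ler_expR.
have E0 : 0 < E by rewrite hE expR_gt0.
have [b hb] : {b | b = B x y} by exists (B x y).
have /andP[bE Eb] := cosh_le_expR x y; rewrite -hE -hb in bE Eb.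
have [lam hlam] : {lam | lam = u ^+ 2 / E} by exists (u ^+ 2 / E).
have u0 : 0 < u by apply: lt_le_trans u1.
have lam0 : 0 < lam by rewrite hlam divr_gt0// exprn_gt0.
have lamE : lam * E = u ^+ 2 by rewrite hlam divfK// gt_eqF.
have lamu : lam <= u by rewrite hlam ler_pdivrMr// expr2 ler_pM2l.
have lB1 : lam * b <= u ^+ 2 by rewrite -lamE ler_pM2l.
have lB2 : u ^+ 2 <= 2 * (lam * b) by rewrite -lamE mulrCA ler_pM2l.
have lam2 : lam ^+ 2 <= u ^+ 2 by rewrite ler_pXn2r// nnegrE ltW.
have u2 : 1 <= u ^+ 2 by rewrite expr_ge1// ltW.
have [n2 hn2] : {n2 | n2 = 1 + lam ^+ 2 + 2 * lam * b}.
  by exists (1 + lam ^+ 2 + 2 * lam * b).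
have n2l : u ^+ 2 <= n2 by have := sqr_ge0 lam; rewrite hn2 => ?; lra.
have n2r : n2 <= (2 * u) ^+ 2.
  have -> : (2 * u) ^+ 2 = 4 * u ^+ 2 by ring.
  by rewrite hn2; lra.
have n20 : 0 < n2 by apply: lt_le_trans n2l; apply: lt_le_trans u2.
have [n hn] : {n | n = Num.sqrt n2} by exists (Num.sqrt n2).
have n0 : 0 < n by rewrite hn sqrtr_gt0.
have nn : n ^+ 2 = n2 by rewrite hn sqr_sqrtr// ltW.
have un : u <= n.
  by rewrite -(@ler_pXn2r _ 2)// ?nnegrE ?(ltW u0) ?(ltW n0)// nn.
have nu : n <= 2 * u.
  have u20 : 0 <= 2 * u by rewrite mulr_ge0// ltW.
  by rewrite -(@ler_pXn2r _ 2)// ?nnegrE ?(ltW n0)// nn.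
pose zv := n^-1 *: (val x + lam *: val y).
have zP : (0 < zv 0 0) && (L zv zv == -1).
  have /andP[x0 _] := valP x; have /andP[y0 _] := valP y.
  apply/andP; split.
    rewrite /zv !mxE; apply: mulr_gt0; first by rewrite invr_gt0.
    apply: addr_gt0; first exact: x0.
    exact: mulr_gt0 lam0 y0.
  rewrite /zv !lorentzE !hyperbolic_norm (lorentzC (val y)).
  rewrite (_ : n^-1 * _ = - (n2 / n ^+ 2)); last first.
    by rewrite hn2 hb; field; rewrite gt_eqF.
  by rewrite nn divff ?eqxx// gt_eqF.
pose z : H := exist _ zv zP; exists z.
have Bxz : B x z = (1 + lam * b) / n.
  by rewrite hb /= /zv !lorentzE hyperbolic_norm; ring.
have Bzy : B z y = (lam + b) / n.
  by rewrite hb /= /zv !lorentzE hyperbolic_norm; ring.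
have near (X T : R) : T / 4 <= X -> X <= 4 * T -> 0 < T -> 0 < X ->
    `|ln X - ln T| <= ln 4.
  move=> h1 h2 T0 X0; rewrite ler_norml; apply/andP; split.
    by rewrite lerBrDr addrC -ler_expR expRD expRN !lnK ?posrE//.
  by rewrite lerBlDr -ler_expR expRD !lnK ?posrE.
have dE p q : d p q = ln (expR (d p q)) by rewrite expRK.
have /andP[xz1 xz2] := cosh_le_expR x z; have /andP[zy1 zy2] := cosh_le_expR z y.
rewrite Bxz in xz1 xz2; rewrite Bzy in zy1 zy2.
split.
  rewrite (dE x z) -(expRK t) -hu; apply: near; [| |exact: u0|exact: expR_gt0].
    apply: le_trans xz1; rewrite ler_pdivlMr//.
    have : u / 4 * n <= u / 4 * (2 * u) by rewrite ler_pM2l// divr_gt0.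
    by rewrite expr2 in lB2; clear -lB2; lra.
  apply: le_trans xz2 _; rewrite mulrA ler_pdivrMr//.
  have : 4 * u * u <= 4 * u * n by rewrite ler_pM2l// mulr_gt0.
  by rewrite expr2 in lB1 u2; clear -lB1 u2; lra.
have Eu0 : 0 < E / u by rewrite divr_gt0.
rewrite (dE z y) -(expRK (d x y - t)) expRD expRN -hu -hE.
apply: near; [| |exact: Eu0|exact: expR_gt0].
  apply: le_trans zy1; rewrite ler_pdivlMr//.
  rewrite (_ : E / u / 4 * n = E * n / 4 / u); last by ring.
  rewrite ler_pdivrMr//.
  have : E * n <= E * (2 * u) by rewrite ler_pM2l.
  have : 0 <= lam * u by rewrite mulr_ge0// ltW.
  have : E * u <= 2 * b * u by rewrite ler_pM2r.
  by clear; lra.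
apply: le_trans zy2 _; rewrite (mulrA 2) ler_pdivrMr//.
rewrite (_ : 4 * (E / u) * n = 4 * E * n / u); last by ring.
rewrite ler_pdivlMr//.
have : E * u <= E * n by rewrite ler_pM2l.
have : b * u <= E * u by rewrite ler_pM2r.
have : lam * u <= E * u by rewrite ler_pM2r// (le_trans lamu).
by clear; lra.
Qed.

End HyperbolicMetric.

Lemma lorentz_norm_triangle (R : realType) (N : nat) (u v w : 'rV[R]_N.+1) :
  lorentz w w < 0 -> lorentz u w = 0 -> lorentz v w = 0 ->
  Num.sqrt (lorentz (u + v) (u + v)) <=
    Num.sqrt (lorentz u u) + Num.sqrt (lorentz v v).
Proof.
move=> ww uw vw.
have u0 := lorentz_orth_ge0 ww uw; have v0 := lorentz_orth_ge0 ww vw.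
have := lorentz_cauchy_schwarz ww uw vw => cs.
rewrite -(@ler_pXn2r _ 2)// ?nnegrE ?addr_ge0 ?sqrtr_ge0//.
rewrite sqrrD !sqr_sqrtr//; last first.
  by apply: (lorentz_orth_ge0 ww); rewrite lorentzE uw vw addr0.
rewrite !lorentzE (lorentzC v u) -sqrtrM//.
have : lorentz u v <= Num.sqrt (lorentz u u * lorentz v v).
  apply: le_trans (ler_norm _) _; rewrite -sqrtr_sqr.
  by rewrite ler_sqrt// mulr_ge0.
by move=> h; lra.
Qed.

(** In the coordinates p = e^(-d(x,o)), q = e^(-d(y,o)), E = e^(d(x,y)) the
    number E p q is the square of the visual quantity, and the bracketed
    expression is a quarter of the Lorentz square of x / B(x,o) - y / B(y,o). *)
Lemma visual_chord_estimate (R : realFieldType) (E e p q cx cy tau : R) :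
  0 <= e <= 1 -> 0 <= E * p * q <= 8 ->
  0 <= p <= 1 -> 0 <= q <= 1 -> p <= tau -> q <= tau ->
  1 - p ^+ 2 <= cx <= 1 -> 1 - q ^+ 2 <= cy <= 1 ->
  `|E * p * q - ((E + e) * p * q * cx * cy - (p * cx) ^+ 2 - (q * cy) ^+ 2)|
    <= (5 * tau) ^+ 2.
Proof.
move=> /andP[e0 e1] /andP[s0 s8] /andP[p0 p1] /andP[q0 q1] pt qt
  /andP[cx0 cx1] /andP[cy0 cy1].
have p2 : p ^+ 2 <= 1 by rewrite expr_le1.
have q2 : q ^+ 2 <= 1 by rewrite expr_le1.
have cxp : 0 <= cx by lra.
have cyp : 0 <= cy by lra.
have pt2 : p ^+ 2 <= tau ^+ 2 by rewrite ler_pXn2r ?nnegrE//; lra.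
have qt2 : q ^+ 2 <= tau ^+ 2 by rewrite ler_pXn2r ?nnegrE//; lra.
have pq : p * q <= tau ^+ 2 by rewrite expr2 ler_pM.
have pq0 : 0 <= p * q by rewrite mulr_ge0.
have cc1 : cx * cy <= 1 by rewrite mulr_ile1.
have cc0 : 0 <= cx * cy by rewrite mulr_ge0.
have cc : 1 - p ^+ 2 - q ^+ 2 <= cx * cy.
  have h : (1 - p ^+ 2) * (1 - q ^+ 2) <= cx * cy by rewrite ler_pM//; lra.
  have : 0 <= p ^+ 2 * q ^+ 2 by rewrite mulr_ge0// sqr_ge0.
  by lra.
have epq : 0 <= e * (p * q) <= tau ^+ 2.
  apply/andP; split; first by rewrite mulr_ge0.
  by apply: le_trans pq; rewrite ler_piMl.
have epqc : 0 <= e * (p * q) * (cx * cy) <= tau ^+ 2.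
  case/andP: epq => h1 h2; apply/andP; split; first by rewrite mulr_ge0.
  by apply: le_trans h2; rewrite ler_piMr.
set s := E * p * q in s0 s8 *.
have sc1 : s * (cx * cy) <= s by rewrite ler_piMr.
have sc2 : s * (1 - p ^+ 2 - q ^+ 2) <= s * (cx * cy) by rewrite ler_wpM2l.
have sp : s * p ^+ 2 <= 8 * tau ^+ 2 by rewrite ler_pM// sqr_ge0.
have sq : s * q ^+ 2 <= 8 * tau ^+ 2 by rewrite ler_pM// sqr_ge0.
have xc : 0 <= (p * cx) ^+ 2 <= tau ^+ 2.
  rewrite sqr_ge0/= ler_pXn2r ?nnegrE//; [|exact: mulr_ge0|lra].
  by apply: le_trans pt; rewrite ler_piMr.
have yc : 0 <= (q * cy) ^+ 2 <= tau ^+ 2.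
  rewrite sqr_ge0/= ler_pXn2r ?nnegrE//; [|exact: mulr_ge0|lra].
  by apply: le_trans qt; rewrite ler_piMr.
have -> : (E + e) * p * q * cx * cy = s * (cx * cy) + e * (p * q) * (cx * cy).
  by rewrite /s; ring.
have -> : (5 * tau) ^+ 2 = 25 * tau ^+ 2 by ring.
move: xc yc epqc => /andP[? ?] /andP[? ?] /andP[? ?].
have sE : s * (1 - p ^+ 2 - q ^+ 2) = s - s * p ^+ 2 - s * q ^+ 2 by ring.
by rewrite ler_norml; apply/andP; split; lra.
Qed.

Lemma ler_dist_sqrt (R : rcfType) (a b c : R) : 0 <= a -> 0 <= c ->
  `|a ^+ 2 - b| <= c ^+ 2 -> `|a - Num.sqrt b| <= c.
Proof.
move=> a0 c0; have [b0|/ltW b0] := leP 0 b; last first.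
  rewrite (ler0_sqrtr b0) subr0 ler_norml => /andP[_ h].
  by rewrite ger0_norm// -(@ler_pXn2r _ 2)// ?nnegrE//; lra.
rewrite -{1}(sqr_sqrtr b0); move: (sqrtr_ge0 b); move: (Num.sqrt b) => s s0.
rewrite !ler_norml => /andP[h1 h2]; apply/andP; split.
- rewrite leNgt; apply/negP => h; have : c ^+ 2 < (s - a) ^+ 2.
    by rewrite ltr_pXn2r ?nnegrE//; lra.
  have : 0 <= a * (s - a) by rewrite mulr_ge0//; lra.
  by move: h1; rewrite !expr2; lra.
- rewrite leNgt; apply/negP => h; have : c ^+ 2 < (a - s) ^+ 2.
    by rewrite ltr_pXn2r ?nnegrE//; lra.
  have : 0 <= s * (a - s) by rewrite mulr_ge0//; lra.
  by move: h2; rewrite !expr2; lra.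
Qed.

Section VisualHyperbolic.
Variables (R : realType) (N : nat) (o : hyperbolic R N).
Local Notation H := (hyperbolic R N).
Implicit Types x y z : H.
Local Notation L := (@lorentz R N).
Local Notation d := (@hdist R N).
Local Notation B x y := (- L (val x) (val y)).

(** The representative of the point in the affine chart of vectors whose Lorentz
    product with o is -1; differences of such vectors are spacelike. *)
Definition projective_point x : 'rV[R]_N.+1 := (B x o)^-1 *: val x.

(** Towards infinity this becomes the visual distance: the boundary sphere lies
    in the affine chart, and half its chordal distance is visual. *)
Definition chord x y : R :=
  Num.sqrt (L (projective_point x - projective_point y)
              (projective_point x - projective_point y) / 4).

Lemma chord_triangle x y z : chord x y <= chord x z + chord z y.
Proof.
have oo : L (val o) (val o) < 0 by rewrite hyperbolic_norm ltrN10.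
have orth a b : L (projective_point a - projective_point b) (val o) = 0.
  have a1 := cosh_ge1 a o; have b1 := cosh_ge1 b o.
  rewrite /projective_point !lorentzE.
  have lin (c : H) : (B c o)^-1 * L (val c) (val o) = - 1.
    by have c1 := cosh_ge1 c o; field; lra.
  by rewrite !lin subrr.
have sq a b : chord a b = Num.sqrt (L (projective_point a - projective_point b)
    (projective_point a - projective_point b)) * Num.sqrt (4^-1).
  by rewrite /chord sqrtrM// (lorentz_orth_ge0 oo).
rewrite !sq -mulrDl ler_wpM2r ?sqrtr_ge0//.
rewrite (_ : projective_point x - projective_point y =
  (projective_point x - projective_point z) +
  (projective_point z - projective_point y)).
  exact: lorentz_norm_triangle oo _ _.
by rewrite addrA subrK.
Qed.

Lemma visual_chord M x y : M <= d x o -> M <= d y o ->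
  `|visual d o x y - chord x y| <= 5 * expR (- M).
Proof.
move=> Mx My; apply: ler_dist_sqrt; first exact: expR_ge0.
  by rewrite mulr_ge0// expR_ge0.
have [p hp] : {p | p = expR (- d x o)} by exists (expR (- d x o)).
have [q hq] : {q | q = expR (- d y o)} by exists (expR (- d y o)).
have [E hE] : {E | E = expR (d x y)} by exists (expR (d x y)).
have [bx hbx] : {bx | bx = B x o} by exists (B x o).
have [by_ hby] : {by_ | by_ = B y o} by exists (B y o).
have [b hb] : {b | b = B x y} by exists (B x y).
have p0 : 0 < p by rewrite hp expR_gt0.
have q0 : 0 < q by rewrite hq expR_gt0.
have E0 : 0 < E by rewrite hE expR_gt0.
have p1 : p <= 1 by rewrite hp -expR0 ler_expR lerNl oppr0 hdist_ge0.
have q1 : q <= 1 by rewrite hq -expR0 ler_expR lerNl oppr0 hdist_ge0.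
have E1 : 1 <= E by rewrite hE -expR0 ler_expR hdist_ge0.
have -> : visual d o x y ^+ 2 = E * p * q.
  rewrite /visual -expRM_natl /gromov_product hE hp hq -!expRD; congr expR.
  by move: (d x y) (d x o) (d y o) => e1 e2 e3; clear; lra.
have bxE : bx = (p^-1 + p) / 2.
  have := cosh_hdist x o; rewrite hbx hp -expRN opprK => ->.
  by rewrite mulrC mulKf.
have byE : by_ = (q^-1 + q) / 2.
  have := cosh_hdist y o; rewrite hby hq -expRN opprK => ->.
  by rewrite mulrC mulKf.
have bE : 2 * b = E + E^-1 by rewrite hb hE -expRN cosh_hdist.
have c2 (t : R) : 0 < 1 + t ^+ 2 by rewrite ltr_pwDl// sqr_ge0.
have inv_cosh (t : R) : 0 < t -> ((t^-1 + t) / 2)^-1 = 2 * t * (1 + t ^+ 2)^-1.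
  move=> t0; have -> : (t^-1 + t) / 2 = (1 + t ^+ 2) / (2 * t).
    by field; rewrite gt_eqF.
  by rewrite invf_div.
have cb (t : R) : 1 - t ^+ 2 <= (1 + t ^+ 2)^-1 <= 1.
  have := c2 t; have := sqr_ge0 t; clear; move: (t ^+ 2) => u u0 u2.
  have u4 : 0 <= u * u by rewrite mulr_ge0.
  apply/andP; split; last by rewrite invf_le1// lerDl.
  by rewrite -(ler_pM2r u2) mulVf ?gt_eqF//; lra.
have [cx hcx] : {cx | cx = (1 + p ^+ 2)^-1} by exists ((1 + p ^+ 2)^-1).
have [cy hcy] : {cy | cy = (1 + q ^+ 2)^-1} by exists ((1 + q ^+ 2)^-1).
have -> : L (projective_point x - projective_point y)
    (projective_point x - projective_point y) / 4 =
  (E + E^-1) * p * q * cx * cy - (p * cx) ^+ 2 - (q * cy) ^+ 2.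
  rewrite /projective_point -hbx -hby !lorentzE !hyperbolic_norm.
  rewrite (lorentzC (val y) (val x)) -[L (val x) (val y)]opprK -hb -bE.
  by rewrite bxE byE !inv_cosh// -hcx -hcy; field.
apply: visual_chord_estimate.
- by rewrite invr_ge0 (ltW E0)/= invf_le1.
- have h1 := cosh_ptolemy x y o o; rewrite hyperbolic_norm opprK mulr1 in h1.
  rewrite -hb -hbx -hby in h1.
  have /andP[_ h2] := cosh_le_expR x y; rewrite -hE -hb in h2.
  have px : bx * p <= 1.
    have /andP[h _] := cosh_le_expR x o.
    by rewrite hbx hp expRN ler_pdivrMr ?expR_gt0// mul1r.
  have qy : by_ * q <= 1.
    have /andP[h _] := cosh_le_expR y o.
    by rewrite hby hq expRN ler_pdivrMr ?expR_gt0// mul1r.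
  have b1 : 0 < bx by rewrite hbx (lt_le_trans _ (cosh_ge1 x o)).
  have b2 : 0 < by_ by rewrite hby (lt_le_trans _ (cosh_ge1 y o)).
  clear -px qy b1 b2 p0 q0 E0 h1 h2.
  apply/andP; split; first by rewrite !mulr_ge0// ltW.
  have h3 : (bx * p) * (by_ * q) <= 1.
    by apply: mulr_ile1 => //; rewrite mulr_ge0// ltW.
  have pq0 : 0 < p * q by rewrite mulr_gt0.
  have h4 : E <= 8 * (bx * by_) by lra.
  have : E * (p * q) <= 8 * (bx * by_) * (p * q) by rewrite ler_pM2r.
  by lra.
- by rewrite (ltW p0).
- by rewrite (ltW q0).
- by rewrite hp ler_expR lerN2.
- by rewrite hq ler_expR lerN2.
- by rewrite hcx cb.
- by rewrite hcy cb.
Qed.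

(** The chord is an exact distance, and the visual quantity is exponentially
    close to it; three comparisons with error 5 e^(-M) give the constant 15. *)
Lemma visual_space_hyperbolic : visual_space d setT o 15.
Proof.
split=> [x _|x y _ _|M x y z _ _ _ Mx My Mz].
- exact: hdistxx.
- exact: hdistC.
have := visual_chord Mx My; have := visual_chord Mx Mz.
have := visual_chord Mz My; have := chord_triangle x y z.
move: (visual d o x y) (visual d o x z) (visual d o z y) => v1 v2 v3.
move: (chord x y) (chord x z) (chord z y) (expR (- M)) => c1 c2 c3 e; clear.
rewrite !ler_norml => h /andP[? ?] /andP[? ?] /andP[? ?].
by lra.
Qed.

End VisualHyperbolic.

(** * Asymptotic cones *)

(** Hyperbolicity and segments are required only up to an additive constant,
    which rescaling removes in the limit. *)
Record rough_hyperbolic (R : realType) (X : Type) (d : X -> X -> R) (c : R)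
    : Prop := RoughHyperbolic {
  rh_ge0 : forall x y, 0 <= d x y;
  rh_diag : forall x, d x x = 0;
  rh_sym : forall x y, d x y = d y x;
  rh_product : forall x y z w,
    Num.min (gromov_product d w x z) (gromov_product d w z y) - c
      <= gromov_product d w x y;
  rh_geodesic : forall x y t, 0 <= t <= d x y ->
    exists z, `|d x z - t| <= c /\ `|d z y - (d x y - t)| <= c }.

Lemma rough_hyperbolic_hdist (R : realType) (N : nat) :
  rough_hyperbolic (@hdist R N) (ln 16).
Proof.
split; [exact: hdist_ge0|exact: hdistxx|exact: hdistC|exact: hyperbolic_product|].
move=> x y t /rough_geodesic[z [h1 h2]]; exists z.
have l : ln 4 <= ln 16 :> R by rewrite ler_ln ?posrE// ler_nat.
by split; apply: le_trans l.
Qed.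

Lemma ultra_fmap (T U : Type) (f : T -> U) (F : set_system T) :
  UltraFilter F -> UltraFilter (f @ F).
Proof.
move=> UF; have PF : ProperFilter F by exact: ultra_proper.
split=> [|G PG FG]; first exact: fmap_proper_filter.
apply/seteqP; split=> // A GA.
have [//|FnA] := in_ultra_setVsetC (f @^-1` A) UF.
have GnA : G (~` A) by exact: FG.
pose proof (filterI GA GnA) as G0; rewrite setICr in G0.
by case: (filter_not_empty G G0).
Qed.

Lemma ultra_cvg_bounded (R : realType) (F : set_system nat) (u : nat -> R)
    (b : R) :
  UltraFilter F -> (\forall k \near F, `|u k| <= b) -> exists l : R, u @ F --> l.
Proof.
move=> UF ub; have PF : ProperFilter F by exact: ultra_proper.
have UG := ultra_fmap u UF.
have : compact (`[- b, b] : set R) by exact: segment_compact.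
rewrite compact_ultra => /(_ (u @ F) UG)[|l [_ ul]]; last by exists l.
by apply: filterS ub => k; rewrite ler_norml /= in_itv.
Qed.

Section Cone.
Variables (R : realType) (X : Type) (d : X -> X -> R) (c : R).
Hypothesis RH : rough_hyperbolic d c.
Variables (omega : set_system nat) (r : nat -> R) (o : nat -> X).
Hypothesis UF : UltraFilter omega.
Hypothesis r_oo : r @ omega --> +oo.
Implicit Types (x y z : nat -> X) (a b e f : set (nat -> X)).

Local Notation cseq := (cone_seq d omega r o).
Local Notation class := (cone_class d omega r o).
Local Notation dw := (cone_dist d omega r).
Local Notation dr x y := (fun k => (r k)^-1 * d (x k) (y k)).

Let PF : ProperFilter omega. Proof. exact: ultra_proper. Qed.

(** The product inequality based at the third point s. *)
Lemma rough_triangle p q s : d p q <= d p s + d s q + 2 * c.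
Proof.
have := rh_product RH p q s s.
rewrite /gromov_product !(rh_diag RH) (rh_sym RH s q) addr0 !add0r.
by rewrite !subrr mul0r minxx; lra.
Qed.

Lemma scale_gt0 : \forall k \near omega, 0 < r k.
Proof. by move/cvgryPgt/(_ 0) : r_oo. Qed.

Lemma scale_inv0 (t : R) : (fun k => (r k)^-1 * t) @ omega --> (0 : R).
Proof.
pose proof ((gtr0_cvgV0 scale_gt0).2 r_oo) as h.
pose proof (cvgMr_tmp (b := t) h) as ht; rewrite mul0r in ht; exact: ht.
Qed.

Lemma near_cvg_le (u : nat -> R) (l e : R) : 0 < e -> u @ omega --> l ->
  \forall k \near omega, u k <= l + e.
Proof. by move=> e0 ul; apply: (cvgr_le _ ul); rewrite ltrDl. Qed.

Lemma scaled_triangle x y z :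
  \forall k \near omega, dr x z k <= dr x y k + dr y z k + (r k)^-1 * (2 * c).
Proof.
apply: filterS scale_gt0 => k rk0.
by rewrite -!mulrDr ler_pM2l ?invr_gt0// rough_triangle.
Qed.

Lemma cone_seq_of_bound z (b : R) :
  (\forall k \near omega, dr z o k <= b) -> cseq z.
Proof.
move=> zb; apply: (ultra_cvg_bounded UF (b := b)).
apply: filterS (filterI zb scale_gt0) => k [h rk0].
by rewrite ger0_norm// mulr_ge0 ?(rh_ge0 RH)// invr_ge0 ltW.
Qed.

Lemma cone_seq_close x z (l : R) : cseq x -> dr z x @ omega --> l -> cseq z.
Proof.
move=> [l1 xl] zl; apply: (@cone_seq_of_bound z (l + 1 + (l1 + 1) + (0 + 1))).
have h1 := near_cvg_le ltr01 zl; have h2 := near_cvg_le ltr01 xl.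
have h3 := near_cvg_le ltr01 (scale_inv0 (2 * c)).
apply: filterS (filterI (filterI h1 h2) (filterI h3 (scaled_triangle z x o))).
by move=> k [[a1 a2] [a3 a4]]; lra.
Qed.

Lemma scaled_sym x y : dr x y = dr y x.
Proof. by apply/funext => k; rewrite (rh_sym RH). Qed.

Lemma scaled_cvg x y : cseq x -> cseq y -> exists l : R, dr x y @ omega --> l.
Proof.
move=> [l1 xl] [l2 yl].
apply: (ultra_cvg_bounded UF (b := l1 + 1 + (l2 + 1) + (0 + 1))).
have h1 := near_cvg_le ltr01 xl; have h2 := near_cvg_le ltr01 yl.
have h3 := near_cvg_le ltr01 (scale_inv0 (2 * c)).
apply: filterS (filterI (filterI (filterI h1 h2)
  (filterI h3 (scaled_triangle x o y))) scale_gt0).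
move=> k [[[a1 a2] [a3 a4]] rk0].
rewrite ger0_norm; last by rewrite mulr_ge0 ?(rh_ge0 RH)// invr_ge0 ltW.
by move: a4; rewrite (rh_sym RH (o k)); lra.
Qed.

Lemma limit_triangle x y z (l1 l2 l : R) : dr x y @ omega --> l1 ->
  dr y z @ omega --> l2 -> dr x z @ omega --> l -> l <= l1 + l2.
Proof.
move=> h1 h2 h; rewrite -[leRHS]addr0.
exact: (ler_cvg_to h (cvgD (cvgD h1 h2) (scale_inv0 (2 * c)))
  (scaled_triangle x y z)).
Qed.

Lemma cone_class_refl x : cseq x -> class x x.
Proof.
move=> xs; split=> //.
rewrite (_ : (fun k => _) = fun=> 0); first exact: cvg_cst.
by apply/funext => k; rewrite (rh_diag RH) mulr0.
Qed.

Lemma cone_distE x y (l : R) : cseq x -> cseq y -> dr x y @ omega --> l ->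
  dw (class x) (class y) = l.
Proof.
move=> xs ys xyl.
have uniq x' y' l' : class x x' -> class y y' -> dr x' y' @ omega --> l' -> l' = l.
  move=> [x's xx'] [y's yy'] h'.
  have [m xy'] := scaled_cvg xs y's.
  have x'x : dr x' x @ omega --> (0 : R) by rewrite scaled_sym.
  have y'y : dr y' y @ omega --> (0 : R) by rewrite scaled_sym.
  have := limit_triangle x'x xy' h'; have := limit_triangle xx' h' xy'.
  have := limit_triangle xyl yy' xy'; have := limit_triangle xy' y'y xyl.
  by move=> *; apply/eqP; rewrite eq_le; apply/andP; split; lra.
have ex : exists l : R, exists x' y', [/\ class x x', class y y' &
    dr x' y' @ omega --> l].
  by exists l, x, y; split=> //; exact: cone_class_refl.
by have [x' [y' [? ? ?]]] := xgetPex 0 ex; exact: (uniq x' y').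
Qed.

Lemma cone_dist_cvg x y : cseq x -> cseq y ->
  dr x y @ omega --> dw (class x) (class y).
Proof.
by move=> xs ys; have [l xyl] := scaled_cvg xs ys; rewrite (cone_distE xs ys xyl).
Qed.

Lemma cone_class_eq x y : cseq x -> class x y -> class y = class x.
Proof.
move=> xs [ys xy].
have yx : dr y x @ omega --> (0 : R) by rewrite scaled_sym.
have key x1 y1 z1 : cseq x1 -> cseq y1 -> cseq z1 ->
    dr x1 y1 @ omega --> (0 : R) -> dr y1 z1 @ omega --> (0 : R) ->
    dr x1 z1 @ omega --> (0 : R).
  move=> xs1 ys1 zs1 h1 h2; have [l h] := scaled_cvg xs1 zs1.
  have := limit_triangle h1 h2 h; rewrite addr0 => l0.
  have l1 : 0 <= l.
    apply: (cvgr_to_ge h); apply: filterS scale_gt0 => k rk0.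
    by rewrite mulr_ge0 ?(rh_ge0 RH)// invr_ge0 ltW.
  by rewrite (_ : 0 = l)//; apply/eqP; rewrite eq_le l1 l0.
by apply/seteqP; split=> z [zs h]; split=> //;
  [apply: (key x y z)|apply: (key y x z)].
Qed.

Local Notation C := (cone d omega r o).

Lemma cone_dist_ge0 a b : C a -> C b -> 0 <= dw a b.
Proof.
move=> [x xs <-] [y ys <-]; apply: (cvgr_to_ge (cone_dist_cvg xs ys)).
apply: filterS scale_gt0 => k rk0.
by rewrite mulr_ge0 ?(rh_ge0 RH)// invr_ge0 ltW.
Qed.

Lemma cone_dist_diag a : C a -> dw a a = 0.
Proof.
move=> [x xs <-]; apply: cone_distE => //.
by have [] := cone_class_refl xs.
Qed.

Lemma cone_dist_sym a b : C a -> C b -> dw a b = dw b a.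
Proof.
move=> [x xs <-] [y ys <-]; apply: cone_distE => //.
by rewrite scaled_sym; exact: cone_dist_cvg.
Qed.

Lemma cone_gromov_cvg x y w : cseq x -> cseq y -> cseq w ->
  (fun k => (r k)^-1 * gromov_product d (w k) (x k) (y k)) @ omega -->
    gromov_product dw (class w) (class x) (class y).
Proof.
move=> xs ys ws.
pose proof (cvgMr_tmp (b := 2^-1)
  (cvgB (cvgD (cone_dist_cvg xs ws) (cone_dist_cvg ys ws))
    (cone_dist_cvg xs ys))) as h.
rewrite /gromov_product; refine (cvg_ext _ h) => k /=.
rewrite !fctE; ring.
Qed.

(** Dividing by r_k makes the hyperbolicity constant disappear in the limit. The
    ultrafilter decides which of the two products realises the minimum. *)
Lemma cone_product a b e f : C a -> C b -> C e -> C f ->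
  Num.min (gromov_product dw f a e) (gromov_product dw f e b)
    <= gromov_product dw f a b.
Proof.
move=> [x xs <-] [y ys <-] [z zs <-] [v vs <-]; rewrite ge_min.
pose S := [set k | gromov_product d (v k) (x k) (z k) - c
  <= gromov_product d (v k) (x k) (y k)].
have key x1 z1 : cseq x1 -> cseq z1 ->
  (\forall k \near omega, gromov_product d (v k) (x1 k) (z1 k) - c
    <= gromov_product d (v k) (x k) (y k)) ->
  gromov_product dw (class v) (class x1) (class z1)
    <= gromov_product dw (class v) (class x) (class y).
  move=> xs1 zs1 h; rewrite -[leLHS]subr0.
  apply: (ler_cvg_to (cvgB (cone_gromov_cvg xs1 zs1 vs) (scale_inv0 c))
    (cone_gromov_cvg xs ys vs)).
  apply: filterS (filterI h scale_gt0) => k [hk rk0].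
  by rewrite -mulrBr ler_pM2l// invr_gt0.
have [hS|hS] := in_ultra_setVsetC S UF; first by rewrite key.
rewrite (key z y) ?orbT//; apply: filterS hS => k /negP; rewrite -ltNge => lt.
have := rh_product RH (x k) (y k) (z k) (v k).
by rewrite lerBlDr ge_min => /orP[|]; lra.
Qed.

Lemma cone_triangle a b e : C a -> C b -> C e -> dw a b <= dw a e + dw e b.
Proof.
move=> Ca Cb Ce; have := cone_product Ca Cb Ce Ce.
rewrite /gromov_product (cone_dist_sym Ce Cb) !cone_dist_diag//.
by rewrite addr0 add0r !subrr mul0r minxx; lra.
Qed.

Lemma cone_four_point a b e f : C a -> C b -> C e -> C f ->
  dw a b + dw e f <= Num.max (dw a e + dw b f) (dw e b + dw a f).
Proof.
move=> Ca Cb Ce Cf; have := cone_product Ca Cb Ce Cf.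
by rewrite le_max ge_min /gromov_product => /orP[h|h]; apply/orP;
  [left|right]; lra.
Qed.

Lemma cone_geodesic a b (t : R) : C a -> C b -> 0 <= t <= dw a b ->
  exists e, [/\ C e, dw a e = t & dw e b = dw a b - t].
Proof.
move=> [x xs <-] [y ys <-]; set D := dw _ _ => /andP[t0 tD].
have xyD : dr x y @ omega --> D by exact: cone_dist_cvg.
pose s := t / D.
have D0 : 0 <= D by exact: le_trans tD.
have sD : s * D = t.
  have [Dz|Dn] := eqVneq D 0; last by rewrite /s divfK.
  by rewrite Dz mulr0; apply/eqP; rewrite eq_le t0 -Dz tD.
have s01 : 0 <= s <= 1.
  rewrite divr_ge0//=; have [Dz|Dn] := eqVneq D 0.
    by rewrite /s Dz invr0 mulr0.
  by rewrite ler_pdivrMr ?mul1r// lt_neqAle eq_sym Dn.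
have ex k : exists p : X, `|d (x k) p - s * d (x k) (y k)| <= c /\
    `|d p (y k) - (d (x k) (y k) - s * d (x k) (y k))| <= c.
  apply: (rh_geodesic RH); case/andP: s01 => s0 s1.
  by rewrite mulr_ge0 ?(rh_ge0 RH)//= ler_piMl ?(rh_ge0 RH).
have [z Hz] := choice ex.
have lim x1 y1 (u : nat -> R) (l : R) : u @ omega --> l ->
    (\forall k \near omega, `|d (x1 k) (y1 k) - r k * u k| <= c) ->
    dr x1 y1 @ omega --> l.
  move=> ul hd; have u0 := scale_inv0 c.
  pose proof (cvgD ul u0) as up; pose proof (cvgB ul u0) as um.
  rewrite addr0 in up; rewrite subr0 in um.
  refine (squeeze_cvgr _ um up); apply: filterS (filterI hd scale_gt0).
  move=> k []; rewrite ler_norml !fctE => /andP[h1 h2] rk0.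
  rewrite -(ler_pM2l rk0) -[X in _ && X](ler_pM2l rk0) mulrBr mulrDr.
  by rewrite !mulVKf ?gt_eqF//; apply/andP; split; lra.
have xzt : dr x z @ omega --> t.
  rewrite -sD; apply: (lim x z (fun k => s * dr x y k)); first exact: cvgMl_tmp.
  apply: filterS scale_gt0 => k rk0.
  by rewrite /= mulrCA mulVKf ?gt_eqF//; case: (Hz k).
have zyt : dr z y @ omega --> D - t.
  rewrite -sD; apply: (lim z y (fun k => dr x y k - s * dr x y k)).
    by apply: cvgB => //; exact: cvgMl_tmp.
  apply: filterS scale_gt0 => k rk0.
  by rewrite /= mulrBr (mulrCA (r k) s) !mulVKf ?gt_eqF//; case: (Hz k).
have zs : cseq z by apply: (cone_seq_close xs (l := t)); rewrite scaled_sym.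
exists (class z); split; [by exists z|exact: cone_distE|exact: cone_distE].
Qed.

Section ConeAction.
Variables (n : nat) (rho : nat -> free_group n -> X -> X).
Hypothesis rho_iso : forall k, isometric_action d (rho k).
Hypothesis displ : forall k i, d (o k) (rho k (fg_gen i) (o k)) <= r k + 1.

Local Notation act := (cone_action d omega r o rho).

Lemma rho_one k p : rho k 1%g p = p.
Proof. by have [] := rho_iso k. Qed.

Lemma rho_mul k g h p : rho k (g * h)%g p = rho k g (rho k h p).
Proof. by have [] := rho_iso k. Qed.

Lemma rho_dist k g p q : d (rho k g p) (rho k g q) = d p q.
Proof. by have [] := rho_iso k. Qed.

Lemma rho_dist_shift k g h p q :
  d (rho k g p) (rho k h q) = d p (rho k (g^-1 * h)%g q).
Proof. by rewrite -(rho_dist k g p) -rho_mul mulgA mulgV mul1g. Qed.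

(** Orbit points stay in the cone because a word of bounded length moves the
    base point by at most a multiple of the scale. *)
Lemma orbit_seq g : cseq (fun k => rho k g (o k)).
Proof.
suff [b hb] : exists b : R,
    \forall k \near omega, d (rho k g (o k)) (o k) <= b * r k.
  apply: (cone_seq_of_bound (b := b)).
  apply: filterS (filterI hb scale_gt0) => k [h rk0].
  by rewrite mulrC ler_pdivrMr.
have r1 : \forall k \near omega, 1 <= r k by move/cvgryPge/(_ 1) : r_oo.
have step h i (e : bool) : let s := if e then fg_gen i else (fg_gen i)^-1%g in
    (exists b : R, \forall k \near omega, d (rho k h (o k)) (o k) <= b * r k) ->
    exists b : R, \forall k \near omega, d (rho k (s * h)%g (o k)) (o k) <= b * r k.
  move=> s [b hb]; exists (b + 2 + 2 * `|c|).
  apply: filterS (filterI hb r1) => k [h1 rk1].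
  have ds : d (rho k s (o k)) (o k) <= r k + 1.
    rewrite /s; case: (e); first by rewrite (rh_sym RH).
    by rewrite -[X in d _ X](rho_one k) rho_dist_shift invgK mulg1.
  have := rough_triangle (rho k (s * h)%g (o k)) (o k) (rho k s (o k)).
  rewrite rho_mul rho_dist => h2; apply: le_trans h2 _.
  have : `|c| <= `|c| * r k by rewrite ler_peMr.
  have := ler_norm c; rewrite mulrDl mulrDl -mulrA; lra.
elim/free_group_ind: g => [|i g|i g].
- exists 0; apply: nearW => k; rewrite rho_one (rh_diag RH) mul0r.
  by [].
- exact: (step g i true).
- exact: (step g i false).
Qed.

Lemma base_seq : cseq o.
Proof.
have := orbit_seq 1%g; rewrite (_ : (fun k => _) = o)//.
by apply/funext => k; rewrite rho_one.
Qed.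

Lemma act_seq x g : cseq x -> cseq (fun k => rho k g (x k)).
Proof.
move=> xs; have [l h] := scaled_cvg xs base_seq.
apply: (cone_seq_close (orbit_seq g) (l := l)).
rewrite (_ : (fun k => _) = dr x o)//.
by apply/funext => k; rewrite rho_dist.
Qed.

Lemma cone_actionE x g : cseq x -> act g (class x) = class (fun k => rho k g (x k)).
Proof.
move=> xs; have gxs := act_seq g xs; apply/seteqP; split=> z.
  move=> [y [ys xy]]; suff -> : class (fun k => rho k g (y k)) =
      class (fun k => rho k g (x k)) by [].
  apply: cone_class_eq => //; split; first exact: act_seq.
  by rewrite (_ : (fun k => _) = dr x y)//; apply/funext => k; rewrite rho_dist.
by move=> h; exists x => //; exact: cone_class_refl.
Qed.

Lemma cone_act a g : C a -> C (act g a).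
Proof.
by move=> [x xs <-]; rewrite cone_actionE//; exists (fun k => rho k g (x k)) => //;
  exact: act_seq.
Qed.

Lemma cone_act_dist a b g : C a -> C b -> dw (act g a) (act g b) = dw a b.
Proof.
move=> [x xs <-] [y ys <-]; rewrite !cone_actionE//.
apply: cone_distE; [exact: act_seq|exact: act_seq|].
rewrite (_ : (fun k => _) = dr x y); first exact: cone_dist_cvg.
by apply/funext => k; rewrite rho_dist.
Qed.

Lemma cone_act_mul a g h : C a -> act (g * h)%g a = act g (act h a).
Proof.
move=> [x xs <-]; rewrite !cone_actionE//; last exact: act_seq.
by congr class; apply/funext => k; rewrite rho_mul.
Qed.

Lemma cone_act1 a : C a -> act 1%g a = a.
Proof.
move=> [x xs <-]; rewrite cone_actionE//.
by congr class; apply/funext => k; rewrite rho_one.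
Qed.

End ConeAction.
End Cone.

(** * The limit action *)

Section LimitAction.
Variables (R : realType) (X : Type) (d : X -> X -> R) (c : R).
Hypothesis RH : rough_hyperbolic d c.
Variables (omega : set_system nat) (r : nat -> R) (o : nat -> X).
Hypothesis UF : UltraFilter omega.
Hypothesis r_oo : r @ omega --> +oo.
Variables (n : nat) (rho : nat -> free_group n -> X -> X).
Hypothesis rho_iso : forall k, isometric_action d (rho k).
Hypothesis rE : r = fun k => min_joint_displacement d (rho k).
Hypothesis o_near_min : forall k, max_displacement d (rho k) (o k) <= r k + 1.

Local Notation act := (cone_action d omega r o rho).
Local Notation dw := (cone_dist d omega r).
Local Notation class := (cone_class d omega r o).
Local Notation C := (cone d omega r o).
Local Notation ow := (class o).

Let PF : ProperFilter omega. Proof. exact: ultra_proper. Qed.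

Lemma displacement_base k i : d (o k) (rho k (fg_gen i) (o k)) <= r k + 1.
Proof. by apply: le_trans (o_near_min k); exact: le_bigmax. Qed.

Lemma scale_le_displacement k p : r k <= max_displacement d (rho k) p.
Proof.
rewrite rE; apply: ge_inf; last by exists p.
exists 0 => _ [q _ <-]; rewrite /max_displacement.
by elim/big_rec: _ => // i s _ s0; rewrite le_max s0 orbT.
Qed.

Let oseq : cone_seq d omega r o o := base_seq RH UF r_oo rho_iso displacement_base.

Lemma cone_base : C ow.
Proof. by exists o. Qed.

Lemma limit_displacement i : dw ow (act (fg_gen i) ow) <= 1.
Proof.
rewrite (cone_actionE RH UF r_oo rho_iso displacement_base _ oseq).
have gs := orbit_seq RH UF r_oo rho_iso displacement_base (fg_gen i).
have h := cone_dist_cvg RH UF r_oo oseq gs.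
pose proof (cvgD (cvg_cst (1 : R)) (scale_inv0 UF r_oo 1)) as h1.
rewrite addr0 in h1; refine (ler_cvg_to h h1 _).
apply: filterS (scale_gt0 UF r_oo) => k rk0.
rewrite !fctE mulr1 ler_pdivrMl// mulrDr mulfV ?gt_eqF// mulr1.
exact: displacement_base.
Qed.

(** A strict inequality in the limit for each of the finitely many generators
    would contradict the minimality of r_k for some k. *)
Lemma joint_displacement_ge1 a : C a -> ~ forall i, dw a (act (fg_gen i) a) < 1.
Proof.
move=> [x xs <-] lt1.
have all_lt : \forall k \near omega, forall i,
    d (x k) (rho k (fg_gen i) (x k)) < r k.
  apply: filter_forall => i; have := lt1 i.
  rewrite (cone_actionE RH UF r_oo rho_iso displacement_base _ xs) => lti.
  have gs := act_seq RH UF r_oo rho_iso displacement_base (fg_gen i) xs.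
  pose proof (cvgr_lt _ (cone_dist_cvg RH UF r_oo xs gs) _ lti) as h.
  apply: filterS (filterI h (scale_gt0 UF r_oo)) => k [hk rk0].
  by move: hk; rewrite mulrC ltr_pdivrMr// mul1r.
have [k [hk rk0]] := filter_ex (filterI all_lt (scale_gt0 UF r_oo)).
have := scale_le_displacement k (x k); rewrite leNgt => /negP; apply.
exact: bigmax_lt.
Qed.

(** The base point minimises the joint displacement, whose minimum is 1. If it
    were at distance delta > 0 from the subtree, let q be a point of the subtree
    almost realising delta. For a generator moving q by more than a little, the
    path from the base point to its image runs close to q and its image, so q is
    moved by about 2 delta less. Thus q would have joint displacement below 1. *)
Lemma base_in_subtree T : closed_convex_invariant_subtree dw act C T -> T ow.
Proof.
move=> [TC [q0 Tq0] Tclosed Tconvex Tinv].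
apply: contrapT => nTo.
have Co := cone_base.
have [e e0 eT] : exists2 e, 0 < e & forall y, T y -> e <= dw ow y.
  apply: contrapT => H; apply: nTo; apply: Tclosed => // e e0.
  apply: contrapT => H'; apply: H; exists e => // y Ty.
  by rewrite leNgt; apply/negP => ylt; apply: H'; exists y.
pose S := [set dw ow y | y in T].
have Sinf : has_inf S.
  by split; [exists (dw ow q0), q0|exists e => _ [y Ty <-]; exact: eT].
pose delta := inf S.
have delta_le y : T y -> delta <= dw ow y.
  by move=> Ty; apply: ge_inf; [exact: Sinf.2|exists y].
have delta0 : 0 < delta.
  apply: lt_le_trans e0 _; apply: lb_le_inf => [|_ [y Ty <-]].
    exact: Sinf.1.
  exact: eT.
(* below 1 / 2 and delta, the bounds needed in the two cases at the end *)
pose eta := Num.min (delta / 2) (1 / 4).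
have eta0 : 0 < eta by rewrite lt_min; apply/andP; split; lra.
have [eta1 eta2] : eta <= delta / 2 /\ eta <= 1 / 4.
  by rewrite /eta; split; rewrite ge_min lexx ?orbT.
have [_ [q Tq <-] qlt] := inf_adherent eta0 Sinf; rewrite -/delta in qlt.
have dC a b := @cone_dist_sym _ _ _ _ RH _ _ o UF r_oo a b.
have dT a b e1 := @cone_triangle _ _ _ _ RH _ _ o UF r_oo a b e1.
have dP a b e1 f1 := @cone_product _ _ _ _ RH _ _ o UF r_oo a b e1 f1.
(* z is the median of the base point, p1 and p2, which lies in T by convexity *)
have med p1 p2 : T p1 -> T p2 -> 2 * delta <= dw ow p1 + dw ow p2 - dw p1 p2.
  move=> T1 T2; have C1 := TC _ T1; have C2 := TC _ T2.
  pose tau := (dw ow p1 + dw p1 p2 - dw ow p2) / 2.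
  have t1 := dT _ _ _ Co C2 C1; have t2 := dT _ _ _ Co C1 C2.
  rewrite (dC _ _ C2 C1) in t2.
  have [|z [Cz z1 z2]] := cone_geodesic RH UF r_oo (t := tau) C1 C2.
    by rewrite /tau; apply/andP; split; lra.
  have Tz : T z by apply: (Tconvex p1 p2 z) => //; rewrite z1 z2 addrC subrK.
  have := delta_le z Tz; have := dP _ _ _ _ Co Cz C2 C1.
  rewrite /gromov_product (dC _ _ Cz C1) (dC _ _ C2 C1) z1 (dC _ _ C2 Cz) z2.
  by rewrite ge_min /tau => /orP[|]; lra.
apply: (joint_displacement_ge1 (TC _ Tq)) => i.
pose s := fg_gen i : free_group n.
have Cq := TC _ Tq; have Tsq : T (act s q) by exact: Tinv.
have TVq : T (act s^-1%g q) by exact: Tinv.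
have Csq := TC _ Tsq; have CVq := TC _ TVq.
have Cso : C (act s ow) by exact: (cone_act RH UF r_oo rho_iso displacement_base).
have dA a b g := @cone_act_dist _ _ _ _ RH _ _ _ UF r_oo _ _ rho_iso
  displacement_base a b g.
have actK p : C p -> act s (act s^-1%g p) = p.
  move=> Cp; rewrite -(cone_act_mul RH UF r_oo rho_iso displacement_base)//.
  by rewrite mulgV (cone_act1 RH UF r_oo rho_iso displacement_base).
have E1 : dw ow (act s^-1%g q) = dw (act s ow) q.
  by rewrite -(dA _ _ s Co CVq) actK.
have E2 : dw (act s^-1%g q) q = dw q (act s q).
  by rewrite -(dA _ _ s CVq Cq) actK.
have E3 : dw (act s ow) (act s q) = dw ow q by exact: dA.
have m1 := med _ _ Tq Tsq; have m2 := med _ _ TVq Tq; rewrite E1 E2 in m2.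
have := limit_displacement i; rewrite -/s => os1.
have := cone_four_point RH UF r_oo Co Csq Cq Cso.
rewrite (dC _ _ Csq Cso) E3 (dC _ _ Cq Cso) le_max => /orP[h|h]; lra.
Qed.

Definition scaled_length (k : nat) (g : free_group n) : R :=
  (r k)^-1 * d (rho k g (o k)) (o k).

Definition limit_length (g : free_group n) : R := dw (act g ow) ow.

Lemma scaled_length_cvg g : (fun k => scaled_length k g) @ omega --> limit_length g.
Proof.
rewrite /limit_length (cone_actionE RH UF r_oo rho_iso displacement_base _ oseq).
apply: (cone_dist_cvg RH UF r_oo) => //.
exact: (orbit_seq RH UF r_oo rho_iso displacement_base).
Qed.

Lemma gromov_scaled_length k g h : 0 < r k ->
  gromov_product d (o k) (rho k g (o k)) (rho k h (o k)) =
    r k * length_product (scaled_length k) g h.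
Proof.
move=> rk0; rewrite /gromov_product /length_product /scaled_length.
rewrite (rho_dist_shift rho_iso) (rh_sym RH (o k)).
by field; rewrite gt_eqF.
Qed.

Lemma gromov_limit_length g h :
  gromov_product dw ow (act g ow) (act h ow) = length_product limit_length g h.
Proof.
have A a g := @cone_act _ _ _ _ RH _ _ _ UF r_oo _ _ rho_iso displacement_base a g.
rewrite /gromov_product /length_product /limit_length; congr ((_ - _) / 2).
rewrite (cone_dist_sym RH UF r_oo (A _ _ cone_base) cone_base).
rewrite -(cone_act_dist RH UF r_oo rho_iso displacement_base g cone_base);
  last exact: (A _ _ cone_base).
rewrite -(cone_act_mul RH UF r_oo rho_iso displacement_base _ _ cone_base).
by rewrite mulgA mulgV mul1g.
Qed.

Lemma hyperbolic_scaled_length k : 0 < r k ->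
  hyperbolic_length (scaled_length k) (c / r k).
Proof.
move=> rk0; split.
- by rewrite /scaled_length (rho_one rho_iso) (rh_diag RH) mulr0.
- move=> g; rewrite /scaled_length; congr (_ * _).
  rewrite -[X in d _ X = _](rho_one rho_iso k) (rho_dist_shift rho_iso).
  by rewrite invgK mulg1 (rh_sym RH).
move=> g h f; rewrite -(ler_pM2l rk0) mulrBr (mulrC _ (c / _)) divfK ?gt_eqF//.
rewrite minr_pMr ?(ltW rk0)// -!gromov_scaled_length//.
exact: (rh_product RH).
Qed.

Lemma hyperbolic_limit_length : hyperbolic_length limit_length 0.
Proof.
have A a g := @cone_act _ _ _ _ RH _ _ _ UF r_oo _ _ rho_iso displacement_base a g.
split.
- rewrite /limit_length (cone_act1 RH UF r_oo rho_iso displacement_base cone_base).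
  exact: (cone_dist_diag RH UF r_oo cone_base).
- move=> g; rewrite /limit_length.
  rewrite -(cone_act_dist RH UF r_oo rho_iso displacement_base g _ cone_base);
    last exact: (A _ _ cone_base).
  rewrite -(cone_act_mul RH UF r_oo rho_iso displacement_base _ _ cone_base) mulgV.
  rewrite (cone_act1 RH UF r_oo rho_iso displacement_base cone_base).
  exact: (cone_dist_sym RH UF r_oo cone_base (A _ _ cone_base)).
move=> g h f; rewrite subr0 -!gromov_limit_length.
apply: (cone_product RH UF r_oo); do ?exact: (A _ _ cone_base); exact: cone_base.
Qed.

(** In a tree the visual quantity is ultrametric. *)
Lemma visual_space_cone T : T `<=` C -> visual_space dw T ow 0.
Proof.
move=> TC; split.
- by move=> a /TC; exact: (cone_dist_diag RH UF r_oo).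
- by move=> a b /TC Ca /TC Cb; exact: (cone_dist_sym RH UF r_oo Ca Cb).
move=> M a b e /TC Ca /TC Cb /TC Ce _ _ _; rewrite mul0r addr0.
have := cone_product RH UF r_oo Ca Cb Ce cone_base; rewrite ge_min => /orP[h|h].
  apply: (@le_trans _ _ (visual dw ow a e)); last by rewrite lerDl expR_ge0.
  by rewrite ler_expR lerN2.
apply: (@le_trans _ _ (visual dw ow e b)); last by rewrite lerDr expR_ge0.
by rewrite ler_expR lerN2.
Qed.

(** The lengths of the finitely many words of length at most m converge, so for
    almost all k they are within 1 of their limits, and length_comparison
    applies to the rescaled orbits. *)
Lemma gromov_comparison (eps : R) : 0 < eps -> schottky dw act ow ->
  \forall k \near omega, 0 < r k /\ exists b, forall g h,
    `|gromov_product d (o k) (rho k g (o k)) (rho k h (o k))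
      - r k * gromov_product dw ow (act g ow) (act h ow)|
    <= eps * (r k * gromov_product dw ow (act g ow) (act h ow)) + b.
Proof.
move=> eps0 [K [K1 HK]].
have qi (g : free_group n) : K^-1 * (word_length g)%:R - K <= limit_length g /\
    limit_length g <= K * (word_length g)%:R + K.
  have := HK g 1%g; rewrite mulg1 word_lengthV.
  by rewrite (cone_act1 RH UF r_oo rho_iso displacement_base cone_base).
have [m Hm] := length_comparison hyperbolic_limit_length K1 qi eps0.
have close : \forall k \near omega, forall g, (word_length g <= m)%N ->
    `|scaled_length k g - limit_length g| <= 1.
  apply: near_short_words => g.
  have h : (fun k => scaled_length k g) @ omega --> limit_length g.
    exact: scaled_length_cvg.
  move/cvgrPdist_le/(_ 1 ltr01) : h => h.
  by apply: filterS h => k; rewrite distrC.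
have c0 : 0 <= c.
  have := rh_product RH (o 0%N) (o 0%N) (o 0%N) (o 0%N).
  by rewrite /gromov_product (rh_diag RH) addr0 subrr mul0r minxx sub0r oppr_le0.
have cr1 : \forall k \near omega, c / r k <= 1.
  have h := near_cvg_le UF ltr01 (scale_inv0 UF r_oo c).
  by apply: filterS h => k; rewrite mulrC add0r.
apply: filterS (filterI (filterI close cr1) (scale_gt0 UF r_oo)).
move=> k [[hk ck] rk0]; split=> //.
have cd : 0 <= c / r k <= 1 by rewrite ck divr_ge0// ltW.
have [b Hb] := Hm _ _ (hyperbolic_scaled_length rk0) cd hk.
exists (r k * b) => g h.
rewrite gromov_scaled_length// gromov_limit_length -mulrBr normrM (gtr0_norm rk0).
by rewrite mulrCA -mulrDr ler_pM2l.
Qed.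

End LimitAction.

(** * Continuity of the dimension *)

Lemma nonprincipal_cofinite (omega : set_system nat) : UltraFilter omega ->
  (forall n, ~ omega [set n]) -> \oo `<=` omega.
Proof.
move=> UF nonpr A [N _ NA]; have PF : ProperFilter omega by exact: ultra_proper.
suff H m : omega [set k | (m <= k)%N] by apply: filterS NA (H N).
elim: m => [|m IH]; first exact: filterS filterT.
have nm : omega (~` [set m]) by have [/nonpr|] := in_ultra_setVsetC [set m] UF.
apply: filterS (filterI IH nm) => k [/= mk km].
by rewrite ltn_neqAle mk andbT; apply/eqP => E; apply: km.
Qed.

(** An infinite limit is allowed: then the second inequality forces u to be
    infinite. *)
Lemma ereal_cvg_ratio (R : realType) (F : set_system nat) (u : nat -> \bar R)
    (D : \bar R) : ProperFilter F -> (0 <= D)%E ->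
  (\forall k \near F, 0 <= u k)%E ->
  (forall e : R, 0 < e < 1 -> \forall k \near F,
     ((1 - e)%:E * u k <= D)%E /\ (D <= (1 + e)%:E * u k)%E) ->
  u @ F --> D.
Proof.
move=> PF D0 u0 H; case: D D0 H => [D| |//] D0 H.
  have half : 0 < (2^-1 : R) < 1 by apply/andP; split; lra.
  have real (e : R) : 0 < e < 1 -> \forall k \near F, [/\ u k \is a fin_num,
      0 <= fine (u k), (1 - e) * fine (u k) <= D & D <= (1 + e) * fine (u k)].
    move=> e01; apply: filterS (filterI u0 (H e e01)) => k /=.
    case: (u k) => [x| |] [x0 [h1 h2]]; last by rewrite leeNy_eq in x0.
      by rewrite -EFinM lee_fin in h1; rewrite -EFinM lee_fin in h2.
    case/andP: e01 => _ e1; move: h1.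
    by rewrite gt0_muley// lte_fin subr_gt0.
  apply/fine_cvgP; split.
    by apply: filterS (real _ half) => k [].
  rewrite lee_fin in D0.
  apply/cvgrPdist_le => e e0.
  pose eps := Num.min 2^-1 (e / (2 * D + 1)).
  have D1 : 0 < 2 * D + 1 by lra.
  have eps0 : 0 < eps by rewrite lt_min invr_gt0 ltr0n divr_gt0.
  have eps1 : eps <= 2^-1 by rewrite ge_min lexx.
  have eps2 : eps * (2 * D + 1) <= e by rewrite -ler_pdivlMr// ge_min lexx orbT.
  have eps01 : 0 < eps < 1 by rewrite eps0/=; lra.
  apply: filterS (real _ eps01) => k [_] /=.
  move: (fine (u k)) => x x0 h1 h2.
  have h3 : eps * x <= 2^-1 * x by rewrite ler_wpM2r.
  have h4 : eps * x <= eps * (2 * D) by rewrite ler_pM2l//; lra.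
  by rewrite ler_norml; apply/andP; split; lra.
apply/cvgeyPge => A; have half : 0 < (2^-1 : R) < 1 by apply/andP; split; lra.
apply: filterS (filterI u0 (H _ half)) => k /=.
case: (u k) => [x| |] [x0 [_ h2]]; last by rewrite leeNy_eq in x0.
  by rewrite -EFinM leye_eq in h2.
by rewrite leey.
Qed.

Theorem theorem5p8 (R : realType) (N r : nat)
    (rho : nat -> free_group r -> hyperbolic R N -> hyperbolic R N)
    (o : nat -> hyperbolic R N) (omega : set_system nat)
    (T : set (set (nat -> hyperbolic R N))) :
  let d := @hdist R N in
  let rk := fun k => min_joint_displacement d (rho k) in
  let X_omega := cone d omega rk o in
  let d_omega := cone_dist d omega rk in
  let o_omega := cone_class d omega rk o o in
  let rho_oo := cone_action d omega rk o rho in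
  (1 <= N)%N -> (2 <= r)%N ->
  (forall k, isometric_action d (rho k)) ->
  rk @ \oo --> +oo ->
  (forall k, max_displacement d (rho k) (o k) <= rk k + 1) ->
  UltraFilter omega -> (forall n : nat, ~ omega [set n]) ->
  minimal_subtree d_omega rho_oo X_omega T ->
  schottky d_omega rho_oo o_omega ->
  (fun k => (rk k)%:E * limit_set_dim d (rho k) setT (o k))%E @ omega -->
    limit_set_dim d_omega rho_oo T o_omega.
Proof.
move=> d rk X_omega d_omega o_omega rho_oo _ _ iso rk_oo near_min UF nonpr
  [subT _] sch.
have PF : ProperFilter omega by exact: ultra_proper.
have RH := rough_hyperbolic_hdist R N.
have r_omega : rk @ omega --> +oo.
  by apply: cvg_trans rk_oo; apply: cvg_app; exact: nonprincipal_cofinite.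
have To := base_in_subtree RH UF r_omega iso erefl near_min subT.
have [TC _ _ _ Tinv] := subT.
have VT := visual_space_cone RH UF r_omega iso near_min TC.
have VH k := visual_space_hyperbolic (o k).
have cmp := gromov_comparison RH UF r_omega iso near_min _ sch.
apply: ereal_cvg_ratio => [||e /andP[e0 e1]].
- exact: Hdim_ge0.
- apply: filterS (scale_gt0 UF r_omega) => k rk0.
  by rewrite mule_ge0 ?Hdim_ge0// lee_fin ltW.
apply: filterS (cmp e e0) => k [rk0 [b Hb]].
pose P g h := gromov_product d_omega o_omega (rho_oo g o_omega) (rho_oo h o_omega).
pose Q g h := gromov_product d (o k) (rho k g (o k)) (rho k h (o k)).
have alpha0 : 0 < rk k * (1 - e) by rewrite mulr_gt0//; lra.
have gamma0 : 0 < rk k * (1 + e) by rewrite mulr_gt0//; lra.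
have beta0 : 0 < (rk k * (1 + e))^-1 by rewrite invr_gt0.
have PQ g h : rk k * (1 - e) * P g h - b <= Q g h.
  by have := Hb g h; rewrite ler_norml => /andP[h1 _]; rewrite /P /Q; lra.
have QP g h : (rk k * (1 + e))^-1 * Q g h - (rk k * (1 + e))^-1 * b <= P g h.
  rewrite -mulrBr ler_pdivrMl//.
  by have := Hb g h; rewrite ler_norml => /andP[_ h1]; rewrite /P /Q; lra.
have To' g : T (rho_oo g o_omega) by exact: Tinv.
have le1 : ((rk k * (1 - e))%:E * limit_set_dim d (rho k) setT (o k) <=
    limit_set_dim d_omega rho_oo T o_omega)%E.
  exact: (limit_set_dim_le VT (VH k) To' _ alpha0 beta0 PQ QP).
have le2 : (((rk k * (1 + e))^-1)%:E * limit_set_dim d_omega rho_oo T o_omega <=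
    limit_set_dim d (rho k) setT (o k))%E.
  exact: (limit_set_dim_le (VH k) VT _ To' beta0 alpha0 QP PQ).
rewrite /= !muleA -!EFinM ![_ * rk k]mulrC; split=> //.
have -> : limit_set_dim d_omega rho_oo T o_omega =
    ((rk k * (1 + e))%:E * (((rk k * (1 + e))^-1)%:E *
      limit_set_dim d_omega rho_oo T o_omega))%E.
  by rewrite muleA -EFinM mulfV ?gt_eqF// mul1e.
by rewrite lee_pmul2l ?lte_fin.
Qed.
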